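(* Let $ABC$ be a nondegenerate triangle in the Euclidean plane with incenter $I$. Let $P,Q$ be independent points uniformly distributed (with respect to area) in the interior of $ABC$, and let $\mathcal D(ABC)$ be the probability that $I$ lies in the closed disk having the segment $PQ$ as a diameter. Then $$\mathcal D(ABC)\le\frac13+\frac{\log3}{6},$$ with equality if and only if $ABC$ is equilateral.
   Context: $\log$ denotes the natural logarithm. *)

(* Defs.v *)
From mathcomp Require Import all_boot all_order all_algebra.
From mathcomp Require Import all_classical all_reals all_analysis.
Set Implicit Arguments.
Unset Strict Implicit.
Unset Printing Implicit Defensive.
Import Order.TTheory GRing.Theory Num.Theory.
Import numFieldNormedType.Exports.
Local Open Scope classical_set_scope.
Local Open Scope ring_scope.

Section PlaneGeometry.
Context {R : realType}.
Implicit Types A B C I P Q X Y Z : R * R.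

(* The library's norm on R * R is the sup norm, hence an explicit Euclidean
   distance. *)
Definition edist X Y : R :=
  Num.sqrt ((X.1 - Y.1) ^+ 2 + (X.2 - Y.2) ^+ 2).

Definition ecircle I (r : R) : set (R * R) := [set X | edist I X = r].

Definition edisk I (r : R) : set (R * R) := [set X | edist I X <= r].

Definition segment X Y : set (R * R) :=
  [set Z | exists t : R, 0 <= t <= 1 /\ Z = (1 - t) *: X + t *: Y].

Definition triangle A B C : set (R * R) :=
  [set Z | exists a b c : R, [/\ 0 <= a, 0 <= b, 0 <= c, a + b + c = 1 &
                                 Z = a *: A + b *: B + c *: C]].

Definition collinear A B C : Prop :=
  exists a b c : R, (a, b) <> (0, 0) /\
    forall X, X \in [:: A; B; C] -> a * X.1 + b * X.2 = c.

Definition nondegenerate_triangle A B C : Prop := ~ collinear A B C.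

Definition tangent_to_side I (r : R) X Y : Prop :=
  exists T : R * R, ecircle I r `&` segment X Y = [set T].

Definition is_incircle A B C I (r : R) : Prop :=
  [/\ 0 < r, edisk I r `<=` triangle A B C,
      tangent_to_side I r A B, tangent_to_side I r B C &
      tangent_to_side I r C A].

Definition is_incenter A B C I : Prop := exists r : R, is_incircle A B C I r.

Definition equilateral A B C : Prop :=
  edist A B = edist B C /\ edist B C = edist C A.

Definition diameter_disk P Q : set (R * R) :=
  edisk (2^-1 *: (P + Q)) (edist P Q / 2).

Definition area : set (R * R) -> \bar R :=
  (@lebesgue_measure R \x @lebesgue_measure R)%E.

End PlaneGeometry.

Section RandomPoints.
Context {R : realType} {d : measure_display} {Omega : measurableType d}.
Variable Pr : probability Omega R.

Definition uniform_on (E : set (R * R)) (X : {RV Pr >-> (R * R)%type}) : Prop :=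
  forall S : set (R * R), measurable S ->
    distribution Pr X S = (area (S `&` E) / area E)%E.

Definition independent (X Y : {RV Pr >-> (R * R)%type}) : Prop :=
  forall S T : set (R * R), measurable S -> measurable T ->
    Pr (X @^-1` S `&` Y @^-1` T) = (Pr (X @^-1` S) * Pr (Y @^-1` T))%E.

End RandomPoints.

(* Main.v *)
Require Import Defs.
From mathcomp Require Import all_boot all_order all_algebra.
From mathcomp Require Import all_classical all_reals all_analysis.
From mathcomp Require Import measurable_realfun.
From mathcomp Require Import ring lra.
Set Implicit Arguments.
Unset Strict Implicit.
Unset Printing Implicit Defensive.
Import Order.TTheory GRing.Theory Num.Theory.
Import numFieldNormedType.Exports.
Local Open Scope classical_set_scope.
Local Open Scope ring_scope.

(** The point I lies in the disk of diameter PQ iff the angle PIQ is not acute.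
    Seen from I, the triangle is cut into three triangles of equal height over
    the sides, so the radial projection of a uniform point to the boundary is
    uniform on the perimeter, and the probability is a sum of nine areas of plane
    regions bounded by hyperbolas.  With u, v, w the tangent lengths in the unit
    of the inradius (u + v + w = uvw), it equals
      (8 (uv + vw + wu) - 12 + psi (u^-2) + psi (v^-2) + psi (w^-2))
        / (4 (u + v + w)^2).
    In terms of a = 1/u, b = 1/v, c = 1/w (ab + bc + ca = 1),
    y = (a + b + c) abc and r = (abc)^2 this is
    2 y + r (psi (a^2) + psi (b^2) + psi (c^2) - 12) / 4.  As a function of the
    cosine of the angle, psi lies below its tangent line at 1/2, except for very
    obtuse angles; since the sum of the cosines is 1 + 4 r / (y - r), Schur's
    inequality 4 y - 1 <= 9 r gives the bound 1/2 + (ln 3 - 1) y / 2, and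
    y <= 1/3 with equality iff a = b = c. *)

(** * Bounds on the logarithm *)

(** The tangent is taken at cosine 1/2 because that is the angle of the equilateral triangle. It
    cannot serve for all angles: as the angle tends to a straight one [psi] tends to 4, but the
    tangent line only to [54 ln 3 - 56 < 4]. The cut is made at squared half-angle tangent 7, that
    is, at cosine -3/4. The sum of the cosines is a rational function of y and r. It is bounded
    below by its linearization along the ray y = 9 r, which contains the equilateral case; the terms
    in [r ln 3] then cancel and Schur's inequality removes r. On the geometric side no orientation
    is fixed: the frame [N], [T] at the incenter may have either handedness, so the argument runs on
    dot products, tangent lengths and absolute values of determinants. The area of the triangle is
    never computed: the probability of each cone over a side is a common factor times the length of
    the side, and total probability 1 determines the factor. *)

Section LogBounds.
Context {R : realType}.
Implicit Types (f : R -> R) (x s : R).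

Lemma derive_ge0_le f (df : R -> R) (a b : R) : a <= b ->
  (forall x, a <= x <= b -> is_derive x 1 f (df x)) ->
  (forall x, a <= x <= b -> 0 <= df x) -> f a <= f b.
Proof.
move=> ab fdf df0; rewrite -subr_ge0.
have [||c cab ->] := @MVT_segment R f df a b ab.
- by move=> x; rewrite in_itv/= => /andP[ax xb]; apply: fdf; rewrite !ltW.
- apply: derivable_within_continuous => x; rewrite in_itv/= => /fdf h.
  exact: ex_derive.
- by rewrite mulr_ge0 ?subr_ge0// df0//; move: cab; rewrite in_itv.
Qed.

Lemma derive_le0_ge f (df : R -> R) (a b : R) : a <= b ->
  (forall x, a <= x <= b -> is_derive x 1 f (df x)) ->
  (forall x, a <= x <= b -> df x <= 0) -> f b <= f a.
Proof.
move=> ab fdf df0; rewrite -lerN2.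
apply: (@derive_ge0_le (\- f) (\- df) a b ab) => x xab.
  by have := fdf _ xab => ?; exact: is_deriveN.
by rewrite oppr_ge0 df0.
Qed.

Lemma is_derive_ln x : 0 < x -> is_derive x 1 (@ln R) x^-1.
Proof. exact: is_derive1_ln. Qed.

Lemma is_derive_ln_comp (g : R -> R) (x dg : R) : 0 < g x ->
  is_derive x 1 g dg -> is_derive x 1 (fun y => ln (g y)) ((g x)^-1 * dg).
Proof. by move=> gx0 hg; exact: (is_derive1_comp (is_derive_ln gx0) hg). Qed.

(** [ln (1 + y) - ln (1 - y)] equals [ln 3] at 1/2 and has a rational derivative, so comparison with
    a polynomial [P] on [0, 1/2] encloses [ln 3]. *)
Let artanh2 (P : R -> R) (y : R) := ln (1 + y) - ln (1 - y) - P y.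

Let is_derive_artanh2 (P dP : R -> R) x : 0 <= x <= 2^-1 ->
  is_derive x 1 P (dP x) ->
  is_derive x 1 (artanh2 P) (2 / (1 - x ^+ 2) - dP x).
Proof.
move=> x1 hP.
have [xl xu] : 0 < 1 + x /\ 0 < 1 - x by split; lra.
have dl : is_derive x 1 (fun y : R => ln (1 + y)) ((1 + x)^-1 * 1).
  apply: (@is_derive_ln_comp (fun y => 1 + y)) => //.
  by apply: is_derive_eq; ring.
have du : is_derive x 1 (fun y : R => ln (1 - y)) ((1 - x)^-1 * (- 1)).
  apply: (@is_derive_ln_comp (fun y => 1 - y)) => //.
  by apply: is_derive_eq; ring.
apply: is_derive_eq; field; apply/and3P; split; apply/eqP; nra.
Qed.

Let artanh2_half (P : R -> R) : P 0 = 0 -> artanh2 P 0 = 0 /\ artanh2 P 2^-1 = ln 3 - P 2^-1.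
Proof.
move=> P0; rewrite /artanh2 P0 addr0 !subr0 subrr; split => //; congr (_ - _).
rewrite -ln_div ?posrE; [|lra..].
by rewrite (_ : 1 - 2^-1 = 2^-1 :> R); [congr ln; field|lra].
Qed.

(** 45/41 is the exact zero of [656 * L - 720], which is the value of [- q] at 7 in the study of [F]
    below. *)
Lemma ln3_lower : 45 / 41 <= ln 3 :> R.
Proof.
(* Taylor polynomial of degree 7; degree 5 gives only about 1.0958 at 1/2, below 45/41. *)
pose P (x : R) := 2 * x + 2 / 3 * x ^+ 3 + 2 / 5 * x ^+ 5 + 2 / 7 * x ^+ 7.
pose dP (x : R) := 2 + 2 * x ^+ 2 + 2 * x ^+ 4 + 2 * x ^+ 6.
have [e0 e1] : artanh2 P 0 = 0 /\ artanh2 P 2^-1 = ln 3 - P 2^-1.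
  by apply: artanh2_half; rewrite /P !expr0n/= !mulr0 !addr0.
have : artanh2 P 0 <= artanh2 P 2^-1.
  apply: (@derive_ge0_le _ (fun x => 2 / (1 - x ^+ 2) - dP x)); first lra.
    move=> x hx; apply: is_derive_artanh2 => //.
    by rewrite /P; apply: is_derive_eq; rewrite /dP /GRing.scale/=; field.
  move=> x hx; rewrite subr_ge0 /dP ler_pdivlMr; last nra.
  have -> : (2 + 2 * x ^+ 2 + 2 * x ^+ 4 + 2 * x ^+ 6) * (1 - x ^+ 2) =
    2 - 2 * (x ^+ 4) ^+ 2 by ring.
  by have := sqr_ge0 (x ^+ 4); lra.
by rewrite e0 e1 /P; lra.
Qed.

Lemma ln3_upper : ln 3 <= 11 / 10 :> R.
Proof.
(* On [0, 1/2] the tail [2 x^4 / (1 - x^2)] of the derivative is at most [8/3 x^4], whence the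
   coefficient 8/15; the value at 1/2 is exactly 11/10. *)
pose P (x : R) := 2 * x + 2 / 3 * x ^+ 3 + 8 / 15 * x ^+ 5.
pose dP (x : R) := 2 + 2 * x ^+ 2 + 8 / 3 * x ^+ 4.
have [e0 e1] : artanh2 P 0 = 0 /\ artanh2 P 2^-1 = ln 3 - P 2^-1.
  by apply: artanh2_half; rewrite /P !expr0n/= !mulr0 !addr0.
have : artanh2 P 2^-1 <= artanh2 P 0.
  apply: (@derive_le0_ge _ (fun x => 2 / (1 - x ^+ 2) - dP x)); first lra.
    move=> x hx; apply: is_derive_artanh2 => //.
    by rewrite /P; apply: is_derive_eq; rewrite /dP /GRing.scale/=; field.
  move=> x hx; rewrite subr_le0 /dP ler_pdivrMr; last nra.
  have -> : (2 + 2 * x ^+ 2 + 8 / 3 * x ^+ 4) * (1 - x ^+ 2) =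
    2 + 2 / 3 * ((x ^+ 2) ^+ 2) * (1 - 4 * x ^+ 2) by field.
  have : 0 <= 1 - 4 * x ^+ 2 by nra.
  by have := sqr_ge0 (x ^+ 2) => h1 h2; have := mulr_ge0 h1 h2; lra.
by rewrite e0 e1 /P; lra.
Qed.

(** * The tangent-line bound for the angle function *)

Let L : R := ln 3.
(** This is [(1 - s)^2 / (8 s)] times the tangent line minus [psi]; the multiplier frees the
    logarithm of its coefficient, so the derivative is rational. *)
Let F s := ln s + (3 / 2 - 5 / 4 * L) * s^-1 + (27 / 4 * L - 15 / 2) * s +
  32 * (L - 1) * (1 + s)^-1 + (22 - 43 / 2 * L).
(** The cofactor left in the derivative of [F] by its two double zeros: [s = 1], from the
    multiplier, and [s = 1/3], the point of tangency. *)
Let q s := (10 - 9 * L) * s ^+ 2 + (32 - 30 * L) * s + (6 - 5 * L).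
Let dF s := - ((1 - s) * (1 - 3 * s) * q s / (2 * s * (1 + s)) ^+ 2).

Let is_derive_F s : 0 < s -> is_derive s 1 F (dF s).
Proof.
move=> s0; have s0' : s != 0 by rewrite gt_eqF.
have s1 : 1 + s != 0 by rewrite gt_eqF//; lra.
have ? := is_derive_ln s0.
have ? : is_derive s 1 (fun t : R => t^-1) (- s ^- 2 *: 1).
  exact: is_deriveV.
have ? : is_derive s 1 (fun t : R => (1 + t)^-1) (- (1 + s) ^- 2 *: 1).
  apply: (@is_deriveV _ (fun t : R => 1 + t)) => //.
  by apply: is_derive_eq; ring.
rewrite /F; apply: is_derive_eq; rewrite /dF /q /GRing.scale/=; field.
by apply/andP; split.
Qed.

Let F1 : F 1 = 0.
Proof. by rewrite /F ln1; field. Qed.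

Let F3 : F 3^-1 = 0.
Proof. by rewrite /F lnV ?posrE; [rewrite -/L; field|lra]. Qed.

(** [q] decreases on (0, 1], is positive at 1/3 and negative on [1, 7]. So [F] falls to 0 at 1/3,
    rises, falls back to 0 at 1 and rises until 7. An upper limit on [s] is unavoidable, since the
    coefficient of [s] in [F] is negative. *)
Let F_ge0 s : 0 < s -> s <= 7 -> 0 <= F s.
Proof.
move=> s0 s7; have L1 := ln3_lower; have L2 := ln3_upper; rewrite -/L in L1 L2.
have sgn t (c : R) : 0 < t -> 0 <= c -> 0 <= c / (2 * t * (1 + t)) ^+ 2.
  by move=> t0 c0; rewrite divr_ge0// sqr_ge0.
have qdec x y : 0 < x -> x <= y -> y <= 1 -> q y <= q x.
  move=> x0 xy y1; rewrite -subr_ge0.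
  have -> : q x - q y = (y - x) * (30 * L - 32 - (10 - 9 * L) * (x + y)).
    by rewrite /q; ring.
  by rewrite mulr_ge0//; nra.
have [s1|s1] := leP 1 s.
  rewrite -F1; apply: (@derive_ge0_le _ dF) => // t /andP[t1 t2].
    by apply: is_derive_F; lra.
  rewrite /dF -mulNr sgn//; first lra.
  rewrite -mulrN mulr_ge0//; first nra.
  (* Linear interpolation of [- q] between 1 and 7 plus the quadratic remainder, whose two factors
     are both nonpositive since [L <= 10/9]. *)
  have -> : - q t = (9 * L - 10) * ((t - 1) * (t - 7)) +
    (t - 1) / 6 * (656 * L - 720) + (7 - t) / 6 * (44 * L - 48).
    by rewrite /q; field.
  by have := mulr_ge0 (_ : 0 <= t - 1) (_ : 0 <= 7 - t); nra.
have [s3|s3] := leP s 3^-1.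
  rewrite -F3; apply: (@derive_le0_ge _ dF) => // t /andP[t1 t2].
    by apply: is_derive_F; lra.
  rewrite /dF oppr_le0 sgn//; first lra.
  rewrite mulr_ge0//; first nra.
  apply: le_trans (qdec t 3^-1 _ _ _); [rewrite /q; lra|lra|lra|lra].
(* The root of [q] between 1/3 and 1 is not located: the sign of [q s] tells whether [F s] is to be
   compared with [F] at 1/3 or at 1. *)
have [qs|qs] := leP 0 (q s).
  rewrite -F3; apply: (@derive_ge0_le _ dF) => [|t /andP[t1 t2]|t /andP[t1 t2]].
  - exact: ltW.
  - by apply: is_derive_F; lra.
  rewrite /dF -mulNr sgn//; first lra.
  rewrite -mulNr mulr_ge0//; first nra.
  apply: le_trans (qdec t s _ _ _) => //; lra.
rewrite -F1; apply: (@derive_le0_ge _ dF) => [|t /andP[t1 t2]|t /andP[t1 t2]].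
- exact: ltW.
- by apply: is_derive_F; lra.
rewrite /dF oppr_le0 sgn//; first lra.
rewrite -[_ * q t]opprK -mulrN oppr_ge0 mulr_le0_ge0//; first nra.
by rewrite oppr_ge0; apply: le_trans (ltW qs); apply: qdec.
Qed.

(* The contribution of an angle to the probability, in terms of the squared
   tangent s of the half-angle; 0 is the limit at s = 1. *)
Definition psi s : R :=
  if s == 1 then 0
  else - 8 * s * ln s / (1 - s) ^+ 2 - 4 * (1 + s) / (1 - s).

Lemma psi3 : psi 3^-1 = 6 * ln 3 - 8.
Proof.
rewrite /psi ifF; last by apply/eqP; lra.
rewrite lnV ?posrE; last lra.
by rewrite (_ : 1 - 3^-1 = 2 / 3 :> R); [field|lra].
Qed.

(* With z = (1 - s) / (1 + s) the cosine of the angle, this is the tangent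
   line at z = 1/2. *)
Lemma psi_le s : 0 < s -> s <= 7 ->
  psi s <= 6 * ln 3 - 8 - 32 * (ln 3 - 1) * ((1 - s) / (1 + s) - 2^-1).
Proof.
move=> s0 s7; have := F_ge0 s0 s7; rewrite /psi; case: eqVneq => [-> _|s1 Fs].
  by have := ln3_lower; lra.
have s0' : s != 0 by rewrite gt_eqF.
have s1' : 1 + s != 0 by rewrite gt_eqF//; lra.
have s1'' : 1 - s != 0 by rewrite subr_eq0 eq_sym.
rewrite -subr_ge0.
have := mulr_ge0 (_ : 0 <= 8 * s / (1 - s) ^+ 2) Fs.
rewrite divr_ge0 ?sqr_ge0//; last lra.
move=> /(_ isT); congr (_ <= _); rewrite /F /L; field.
by rewrite s0' s1' s1''.
Qed.

(** Follows from [ln s >= 1 - 1 / s]. The constant is the limit of [psi] at infinity; it replaces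
    the tangent line at a very obtuse angle. *)
Lemma psi_le4 s : 1 < s -> psi s <= 4.
Proof.
move=> s1; rewrite /psi ifF ?gt_eqF//.
have s1'' : 1 - s != 0 by rewrite subr_eq0 lt_eqF.
have sl : 1 - s^-1 <= ln s.
  have si : 0 < s^-1 by rewrite invr_gt0; lra.
  have := @le_ln1Dx R (s^-1 - 1); rewrite addrCA subrr addr0 lnV ?posrE; last lra.
  by move=> /(_ _); lra.
rewrite -subr_ge0.
have -> : 4 - (- 8 * s * ln s / (1 - s) ^+ 2 - 4 * (1 + s) / (1 - s)) =
  8 * s / (1 - s) ^+ 2 * (ln s - (1 - s^-1)).
  by field; rewrite s1'' gt_eqF//; lra.
by rewrite mulr_ge0 ?subr_ge0// divr_ge0 ?sqr_ge0//; lra.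
Qed.

End LogBounds.

(** * Optimization over triangles *)

Section TriangleInequality.
Context {R : realType}.
Implicit Types a b c u v w : R.

Let L : R := ln 3.

Lemma schur (x y z : R) : 0 <= x -> 0 <= y -> 0 <= z ->
  0 <= x * (x - y) * (x - z) + y * (y - x) * (y - z) + z * (z - x) * (z - y).
Proof.
wlog xy : x y / x <= y => [hw x0 y0 z0|].
  have [xy|/ltW yx] := leP x y; first exact: hw.
  by have := hw _ _ yx y0 x0 z0; congr (_ <= _); ring.
move=> x0 y0 z0.
have [zx|xz] := leP z x.
  have -> : x * (x - y) * (x - z) + y * (y - x) * (y - z) + z * (z - x) * (z - y)
    = (y - x) ^+ 2 * (x + y - z) + z * ((x - z) * (y - z)) by ring.
  by rewrite addr_ge0// mulr_ge0 ?sqr_ge0 ?mulr_ge0 ?subr_ge0//; lra.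
have -> : x * (x - y) * (x - z) + y * (y - x) * (y - z) + z * (z - x) * (z - y)
  = (z - y) ^+ 2 * (y + z - x) + x * ((y - x) * (z - x)) by ring.
by rewrite addr_ge0// mulr_ge0 ?sqr_ge0 ?mulr_ge0 ?subr_ge0//; lra.
Qed.

(* The probability in terms of the tangents a, b, c of the half-angles. *)
Let val a b c := 2 * ((a + b + c) * (a * b * c)) +
  (a * b * c) ^+ 2 * (psi (a ^+ 2) + psi (b ^+ 2) + psi (c ^+ 2) - 12) / 4.

Let cosine a := (1 - a ^+ 2) / (1 + a ^+ 2).

Section Angles.
Variables a b c : R.
Hypotheses (a0 : 0 < a) (b0 : 0 < b) (c0 : 0 < c).
Hypothesis abc : a * b + b * c + c * a = 1.
Let y := (a + b + c) * (a * b * c).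
Let r := (a * b * c) ^+ 2.

Let y_le : y <= 3^-1.
Proof.
have := sqr_ge0 (a * b - b * c); have := sqr_ge0 (b * c - c * a).
have := sqr_ge0 (c * a - a * b).
have : (a * b + b * c + c * a) ^+ 2 = 1 by rewrite abc expr1n.
rewrite /y; lra.
Qed.

Let y_eq : 3^-1 <= y -> a = b /\ b = c.
Proof.
move=> y3; have h1 := sqr_ge0 (a * b - b * c); have h2 := sqr_ge0 (b * c - c * a).
have h3 := sqr_ge0 (c * a - a * b).
have h : (a * b + b * c + c * a) ^+ 2 = 1 by rewrite abc expr1n.
have /eqP : (a * b - b * c) ^+ 2 = 0 by apply/eqP; rewrite eq_le h1 andbT; move: y3; rewrite /y; lra.
have /eqP : (b * c - c * a) ^+ 2 = 0 by apply/eqP; rewrite eq_le h2 andbT; move: y3; rewrite /y; lra.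
rewrite !sqrf_eq0 !subr_eq0 => /eqP bc /eqP ab.
split; [apply: (mulIf (lt0r_neq0 c0)); lra|].
by apply: (mulIf (lt0r_neq0 a0)); lra.
Qed.

(** Schur's inequality for [a b], [b c], [c a], whose elementary symmetric functions are 1, [y] and
    [r]. *)
Let r_ge : 4 * y - 1 <= 9 * r.
Proof.
have := schur (ltW (mulr_gt0 a0 b0)) (ltW (mulr_gt0 b0 c0)) (ltW (mulr_gt0 c0 a0)).
have h : (a * b + b * c + c * a) ^+ 3 = 1 by rewrite abc expr1n.
have -> : 4 * y = 4 * y * (a * b + b * c + c * a) by rewrite abc mulr1.
rewrite /y /r; lra.
Qed.

Let e13 : 0 < a + b + c - a * b * c.
Proof.
have : a * b < 1 by have := mulr_gt0 b0 c0; have := mulr_gt0 c0 a0; move: abc; lra.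
move=> ab1; have : a * b * c < c by rewrite gtr_pMl.
by have := a0; have := b0; lra.
Qed.

(** The classical identity 1 + inradius / circumradius. Substituting [a b + b c + c a] for 1 factors
    every [1 + a^2] as [(a + b) (c + a)]. *)
Let sum_cosine :
  cosine a + cosine b + cosine c = 1 + 4 * (a * b * c) / (a + b + c - a * b * c).
Proof.
have e : a + b + c - a * b * c = (a + b) * (b + c) * (c + a).
  have -> : a + b + c = (a + b + c) * (a * b + b * c + c * a) by rewrite abc mulr1.
  ring.
rewrite /cosine e.
have -> : 1 + a ^+ 2 = (a + b) * (c + a) by rewrite -abc; ring.
have -> : 1 + b ^+ 2 = (a + b) * (b + c) by rewrite -abc; ring.
have -> : 1 + c ^+ 2 = (b + c) * (c + a) by rewrite -abc; ring.
have -> : 1 - a ^+ 2 = a * b + b * c + c * a - a ^+ 2 by rewrite abc.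
have -> : 1 - b ^+ 2 = a * b + b * c + c * a - b ^+ 2 by rewrite abc.
have -> : 1 - c ^+ 2 = a * b + b * c + c * a - c ^+ 2 by rewrite abc.
field.
have [? ? ?] : [/\ a + b != 0, b + c != 0 & c + a != 0].
  by split; apply/lt0r_neq0/addr_gt0.
by apply/and3P; split.
Qed.

(** [(17 r - y) / 16] is the linearization of [4 r^2 / (y - r)] along [y = 9 r]; the error is a
    multiple of the square of [9 a b c - (a + b + c)]. *)
Let r_sum_cosine : r + (17 * r - y) / 16 <= r * (cosine a + cosine b + cosine c).
Proof.
rewrite sum_cosine mulrDr mulr1 lerD2l (mulrA r) ler_pdivlMr ?e13// -subr_ge0.
set e1 := a + b + c; set e3 := a * b * c.
have -> : r * (4 * e3) - (17 * r - y) / 16 * (e1 - e3) =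
   e3 * (9 * e3 - e1) ^+ 2 / 16 by rewrite /r /y -/e1 -/e3; field.
by rewrite divr_ge0// mulr_ge0 ?sqr_ge0// /e3 !mulr_ge0// ltW.
Qed.

Let psi_cosine x : 0 < x -> x ^+ 2 <= 7 ->
  psi (x ^+ 2) <= 6 * L - 8 - 32 * (L - 1) * (cosine x - 2^-1).
Proof. by move=> x0 x7; apply: psi_le => //; rewrite exprn_gt0. Qed.

(** The hypotheses say that the cosines are at least -3/4, so moderately obtuse angles are included
    and the tangent line applies at all three. *)
Lemma val_le_acute : a ^+ 2 <= 7 -> b ^+ 2 <= 7 -> c ^+ 2 <= 7 ->
  val a b c <= 1 / 3 + L / 6 /\ (val a b c = 1 / 3 + L / 6 -> a = b /\ b = c).
Proof.
move=> a7 b7 c7; have L1 : 45 / 41 <= L := ln3_lower.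
have r0 : 0 <= r by exact: sqr_ge0.
have : val a b c <= 2^-1 + (L - 1) / 2 * y.
  have ps : psi (a ^+ 2) + psi (b ^+ 2) + psi (c ^+ 2) - 12 <=
      18 * L - 36 - 32 * (L - 1) * (cosine a + cosine b + cosine c - 3 / 2).
    have := psi_cosine a0 a7; have := psi_cosine b0 b7.
    by have := psi_cosine c0 c7; lra.
  apply: (@le_trans _ _ (2 * y + r * (18 * L - 36 -
       32 * (L - 1) * (cosine a + cosine b + cosine c - 3 / 2)) / 4)).
    by rewrite /val -/y -/r lerD2l ler_pM2r ?ler_wpM2l//; lra.
  have : 0 <= (L - 1) * (r * (cosine a + cosine b + cosine c) -
      (r + (17 * r - y) / 16)).
    by apply: mulr_ge0; [lra|rewrite subr_ge0; exact: r_sum_cosine].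
  (* The terms in [L * r] cancel and leave [2 y - 9 r / 2 + (L - 1) y / 2]. *)
  have := r_ge; lra.
move=> h; split.
  by apply: (le_trans h); have := y_le; nra.
by move=> e; apply: y_eq; move: h; rewrite e; nra.
Qed.

(** The tangent line is used at [a] and [b] only, the constant 4 at [c]. The loss is affordable
    because such a flat triangle keeps [y] well below 1/3. *)
Lemma val_lt_obtuse : 7 < c ^+ 2 -> val a b c < 1 / 3 + L / 6.
Proof.
move=> c7; have L1 : 45 / 41 <= L := ln3_lower.
have r0 : 0 <= r by exact: sqr_ge0.
have ab0 := mulr_gt0 a0 b0; have bc0 := mulr_gt0 b0 c0; have ca0 := mulr_gt0 c0 a0.
have c1 : 1 < c.
  rewrite ltNge; apply/negP => c1; have := exprn_ile1 2 (ltW c0) c1; lra.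
have a1 : a <= 1 by have := a0; have := b0; have := abc; nra.
have b1 : b <= 1 by have := a0; have := b0; have := abc; nra.
have a7 : a ^+ 2 <= 7 by have := exprn_ile1 2 (ltW a0) a1; lra.
have b7 : b ^+ 2 <= 7 by have := exprn_ile1 2 (ltW b0) b1; lra.
have cc : cosine c <= - (3 / 4).
  by rewrite /cosine ler_pdivrMr; lra.
have ps : psi (a ^+ 2) + psi (b ^+ 2) + psi (c ^+ 2) - 12 <= - 12 * L.
  have := psi_cosine a0 a7; have := psi_cosine b0 b7.
  have : psi (c ^+ 2) <= 4 by apply: psi_le4; lra.
  have : 1 <= cosine a + cosine b + cosine c.
    by rewrite sum_cosine lerDl divr_ge0 ?mulr_ge0// ltW.
  nra.
(* From [4 a b c^2 <= (b c + c a)^2 <= 1] and [c^2 > 7]. *)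
have g : 28 * (a * b) <= 1.
  have := sqr_ge0 (a - b) => h.
  have : 0 <= (a - b) ^+ 2 * c ^+ 2 by rewrite mulr_ge0 ?sqr_ge0.
  have : (b * c + c * a) ^+ 2 <= 1 by apply: exprn_ile1; have := abc; lra.
  have : a * b * 7 <= a * b * c ^+ 2 by rewrite ler_wpM2l; lra.
  lra.
(* With [t = a b] one gets [y <= t (1 - t) + (1 - t)^2 / 4 = (1 + 2 t - 3 t^2) / 4], and
   [t <= 1/28]. *)
have yu : y <= 15 / 56.
  have e : c * (a + b) = 1 - a * b by move: abc; lra.
  have -> : y = a * b * (c * (a + b)) + a * b * c ^+ 2 by rewrite /y; ring.
  have : 4 * (a * b * c ^+ 2) <= (c * (a + b)) ^+ 2.
    rewrite -subr_ge0.
    have -> : (c * (a + b)) ^+ 2 - 4 * (a * b * c ^+ 2) = (c * (a - b)) ^+ 2 by ring.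
    exact: sqr_ge0.
  rewrite e; nra.
have : val a b c <= 2 * y - 3 * L * r.
  have -> : 2 * y - 3 * L * r = 2 * y + r * (- 12 * L) / 4 by field.
  by rewrite /val -/y -/r lerD2l ler_pM2r ?ler_wpM2l//; lra.
(* Since [L >= 1], Schur's inequality bounds the value by [(2 y + 1) / 3 <= 43/84], below
   [1/3 + 45/246]. *)
have := r_ge; have : 0 <= (L - 1) * r by rewrite mulr_ge0//; lra.
lra.
Qed.

End Angles.

Let val_le a b c : 0 < a -> 0 < b -> 0 < c -> a * b + b * c + c * a = 1 ->
  val a b c <= 1 / 3 + L / 6 /\ (val a b c = 1 / 3 + L / 6 -> a = b /\ b = c).
Proof.
move=> a0 b0 c0 abc.
have lt x : x < 1 / 3 + L / 6 ->
    x <= 1 / 3 + L / 6 /\ (x = 1 / 3 + L / 6 -> a = b /\ b = c).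
  by move=> h; split; [exact: ltW|move=> e; rewrite e ltxx in h].
have [c7|c7] := ltP 7 (c ^+ 2); first exact/lt/val_lt_obtuse.
have [b7|b7] := ltP 7 (b ^+ 2).
  apply: lt; have -> : val a b c = val c a b by rewrite /val; ring.
  by apply: val_lt_obtuse => //; lra.
have [a7|a7] := ltP 7 (a ^+ 2).
  apply: lt; have -> : val a b c = val b c a by rewrite /val; ring.
  by apply: val_lt_obtuse => //; lra.
exact: val_le_acute.
Qed.

Definition acute_value u v w : R :=
  (8 * (u * v + v * w + w * u) - 12 +
   psi (u ^- 2) + psi (v ^- 2) + psi (w ^- 2)) / (4 * (u + v + w) ^+ 2).

Lemma acute_value_le u v w : 0 < u -> 0 < v -> 0 < w -> u + v + w = u * v * w ->
  acute_value u v w <= 1 / 3 + ln 3 / 6 /\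
  (acute_value u v w = 1 / 3 + ln 3 / 6 <-> u = v /\ v = w).
Proof.
move=> u0 v0 w0 uvw.
have [u0' v0' w0'] : [/\ u != 0, v != 0 & w != 0] by rewrite !gt_eqF.
have e : acute_value u v w = val u^-1 v^-1 w^-1.
  rewrite /acute_value /val uvw !exprVn; field.
  by rewrite u0' v0' w0'.
have s1 : u^-1 * v^-1 + v^-1 * w^-1 + w^-1 * u^-1 = 1.
  have -> : u^-1 * v^-1 + v^-1 * w^-1 + w^-1 * u^-1 = (u + v + w) / (u * v * w).
    by field; rewrite u0' v0' w0'.
  by rewrite uvw divff// !mulf_neq0.
have [le eq] : val u^-1 v^-1 w^-1 <= 1 / 3 + L / 6 /\
    (val u^-1 v^-1 w^-1 = 1 / 3 + L / 6 -> u^-1 = v^-1 /\ v^-1 = w^-1).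
  by apply: val_le; rewrite ?invr_gt0.
rewrite e; split => //; split.
  by move=> /eq[/invr_inj -> /invr_inj ->].
case=> uv vw; subst v w.
have u3 : u ^+ 2 = 3.
  apply: (mulIf u0'); move: uvw; rewrite -exprSr; lra.
rewrite -e /acute_value u3 psi3.
have -> : (u + u + u) ^+ 2 = 9 * u ^+ 2 by ring.
by rewrite -expr2 u3; lra.
Qed.

End TriangleInequality.

(** * Areas in the plane *)

Section PlaneArea.
Context {R : realType}.
Implicit Types (S : set (R * R)) (x y a b : R).
Local Notation mu := (@lebesgue_measure R).

Lemma areaE S : area S = (\int[mu]_x mu (xsection S x))%E.
Proof. by []. Qed.

Lemma measurable_le_set d (X : measurableType d) (f g : X -> R) : measurable_fun setT f ->
  measurable_fun setT g -> measurable [set z | f z <= g z].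
Proof. by move=> mf mg; rewrite -[X in measurable X]setTI; exact: measurable_fun_le. Qed.

Lemma measurable_lt_set d (X : measurableType d) (f g : X -> R) : measurable_fun setT f ->
  measurable_fun setT g -> measurable [set z | f z < g z].
Proof.
move=> mf mg; rewrite (_ : [set z | _] = ~` [set z | g z <= f z]).
  by apply: measurableC; exact: measurable_le_set.
by apply/seteqP; split => z /=; rewrite ltNge => /negP.
Qed.

Lemma measurable_affine (a b c : R) :
  measurable_fun setT (fun z : R * R => a * z.1 + b * z.2 + c).
Proof.
by apply: measurable_funD => //; apply: measurable_funD; apply: measurable_funM.
Qed.

Lemma xsection_interval S x (i : interval R) :
  (forall y, S (x, y) <-> y \in i) -> mu (xsection S x) = mu [set` i].
Proof.
move=> h; congr (mu _); apply/seteqP; split => y; rewrite /xsection/= inE.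
  by move=> /h.
by move=> /h.
Qed.

(** Slicing followed by the fundamental theorem of calculus. The section lengths are asked for on
    the open interval only, so the endpoints, where a section may degenerate, are left aside. *)
Lemma area_strip S (a b : R) (h F : R -> R) : measurable S -> a <= b ->
  (forall z, S z -> a <= z.1 <= b) ->
  (forall x, a < x < b -> mu (xsection S x) = (h x)%:E) ->
  (forall x, a <= x <= b -> derivable h x 1) ->
  (forall x, a <= x <= b -> is_derive x 1 F (h x)) ->
  area S = (F b - F a)%:E.
Proof.
move=> mS ab Sab hS dh dF; rewrite areaE.
have -> : (\int[mu]_x mu (xsection S x) = \int[mu]_(x in `[a, b]) mu (xsection S x))%E.
  rewrite [RHS]integral_mkcond; apply: eq_integral => x _; rewrite patchE.
  case: ifPn => // /negP xab; rewrite (_ : xsection S x = set0) ?measure0//.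
  apply/seteqP; split => // y; rewrite /xsection/= inE => /Sab/= xab'.
  by apply: xab; rewrite inE/= in_itv.
have mx : measurable_fun setT (fun x => mu (xsection S x)).
  exact: measurable_fun_xsection.
move: ab; rewrite le_eqVlt => /predU1P[->|ab].
  by rewrite set_itv1 integral_set1 subrr.
have -> : (\int[mu]_(x in `[a, b]) mu (xsection S x) =
    \int[mu]_(x in `]a, b[) mu (xsection S x))%E.
  by rewrite integral_itv_bndoo//; exact: measurable_funS mx.
have -> : (\int[mu]_(x in `]a, b[) mu (xsection S x) =
    \int[mu]_(x in `]a, b[) (h x)%:E)%E.
  by apply: eq_integral => x; rewrite inE/= in_itv/= => /hS.
have ch : {within `[a, b], continuous h}.
  by apply: derivable_within_continuous => x; rewrite in_itv/=; exact: dh.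
have -> : (\int[mu]_(x in `]a, b[) (h x)%:E = \int[mu]_(x in `[a, b]) (h x)%:E)%E.
  have mh : measurable_fun `]a, b[ h.
    apply: (@measurable_funS _ _ _ _ `[a, b]) => //; first exact: subset_itv_oo_cc.
    exact: subspace_continuous_measurable_fun.
  by rewrite [RHS]integral_itv_bndoo//; exact: measurableT_comp.
apply: continuous_FTC2 => //.
  split.
  - by move=> x; rewrite in_itv/= => /andP[ax xb]; apply: ex_derive; apply: dF; rewrite !ltW.
  - apply/cvg_at_right_filter/differentiable_continuous; rewrite -derivable1_diffP.
    by apply: ex_derive; apply: dF; rewrite lexx ltW.
  - apply/cvg_at_left_filter/differentiable_continuous; rewrite -derivable1_diffP.
    by apply: ex_derive; apply: dF; rewrite lexx ltW.
move=> x; rewrite in_itv/= => /andP[ax xb]; rewrite derive1E.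
by apply: derive_val; apply: dF; rewrite !ltW.
Qed.

Lemma measure_split d (X : measurableType d) (m : {measure set X -> \bar R}) (S T : set X) :
  measurable S -> measurable T -> m S = (m (S `&` T) + m (S `&` ~` T))%E.
Proof.
move=> mS mT; rewrite -{1}(setUIDK S T) setDE measureU//.
- exact: measurableI.
- by apply: measurableI => //; exact: measurableC.
- by rewrite setIACA setICr setI0.
Qed.

Lemma area_split S T : measurable S -> measurable T ->
  area S = (area (S `&` T) + area (S `&` ~` T))%E.
Proof. exact: (@measure_split _ _ (mu \x mu)%E). Qed.



Lemma mu_itv (a b : R) (l r : bool) : a <= b ->
  mu [set` Interval (BSide l a) (BSide r b)] = (b - a)%:E.
Proof.
rewrite lebesgue_measure_itv/= lte_fin => ab; case: ltP => [|ba]; first by rewrite EFinB.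
by rewrite (@le_anti _ _ a b) ?subrr// ab.
Qed.

(** The two branches of the hyperbola [x y = -1] cut off regions of equal area, one with [x < 0 < y]
    and one with [y < 0 < x]. *)
Lemma area_same_side (u v : R) : 0 < u -> 0 < v -> 1 <= u * v ->
  area [set z | [/\ - u <= z.1 < v, - u <= z.2 < v & 1 + z.1 * z.2 <= 0]] =
  (2 * (u * v - 1 - ln (u * v)))%:E.
Proof.
move=> u0 v0 uv1; set S := [set z | _].
have mS : measurable S.
  rewrite (_ : S = [set z | - u <= z.1] `&` [set z | z.1 < v] `&`
    [set z | - u <= z.2] `&` [set z | z.2 < v] `&` [set z | 1 + z.1 * z.2 <= 0]); last first.
    apply/seteqP; split => z /=; first by case=> /andP[-> ->] /andP[-> ->] ->.
    by case=> -[] [] [] a b c d e; split => //; apply/andP.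
  apply: measurableI; last first.
    apply: measurable_le_set => //; apply: measurable_funD => //.
    by apply: measurable_funM.
  by repeat apply: measurableI; (exact: measurable_le_set || exact: measurable_lt_set).
have mT : measurable [set z : R * R | z.1 < 0] by exact: measurable_lt_set.
have [uN vN] : u != 0 /\ v != 0 by rewrite !gt_eqF.
have vu : v^-1 <= u by rewrite -(ler_pM2r v0) mulVf.
have uv : u^-1 <= v by rewrite -(ler_pM2l u0) mulfV.
have v1 : 0 < v^-1 by rewrite invr_gt0.
have u1 : 0 < u^-1 by rewrite invr_gt0.
rewrite (area_split mS mT).
have -> : area (S `&` [set z | z.1 < 0]) = (u * v - 1 - ln (u * v))%:E.
  pose F (x : R) := v * x + ln (- x).
  have -> : u * v - 1 - ln (u * v) = F (- v^-1) - F (- u).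
    by rewrite /F !opprK lnM ?posrE// lnV ?posrE//; field.
  apply: (@area_strip _ (- u) (- v^-1) (fun x => v + x^-1)).
  - exact: measurableI.
  - by rewrite lerN2.
  - move=> -[x y] [[/= /andP[xu xv] /andP[yu yv] xy] /= x0]; rewrite xu/=.
    by rewrite lerNr -(ler_pM2l v0) mulfV//; nra.
  - move=> x /andP[xl xr].
    have x0 : x < 0 by lra.
    have xN : x != 0 by rewrite lt_eqF.
    rewrite (@xsection_interval _ x `[- x^-1, v[).
      rewrite mu_itv; first by congr EFin; ring.
      rewrite lerNl -(ler_nM2l x0) mulfV// mulrN.
      by move: xr; rewrite ltrNr -(ltr_pM2l v0) mulfV//; lra.
    move=> y; rewrite in_itv/=; split.
      case=> -[/= _ /andP[yu ->] xy] _; rewrite andbT.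
      by rewrite lerNl -(ler_nM2l x0) mulfV//; lra.
    move=> /andP[yx yv]; split => //.
    have xy : x * y <= - 1.
      by move: yx; rewrite -(ler_nM2l x0) mulrN mulfV.
    have ? : 0 < y by nra.
    by split => /=; [rewrite (ltW xl)/=; lra|rewrite yv andbT; lra|lra].
  - move=> x /andP[xl xr]; have x0 : x != 0 by rewrite lt_eqF//; lra.
    by apply: ex_derive; apply: is_deriveD; apply: is_deriveV.
  - move=> x /andP[xl xr]; have x0 : 0 < - x by lra.
    have ? : is_derive x 1 (fun y : R => ln (- y)) ((- x)^-1 * - 1).
      exact: is_derive_ln_comp.
    apply: is_derive_eq; rewrite /GRing.scale/=; field.
    by rewrite -oppr_eq0 gt_eqF.
have -> : area (S `&` ~` [set z | z.1 < 0]) = (u * v - 1 - ln (u * v))%:E.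
  pose F (x : R) := u * x - ln x.
  have -> : u * v - 1 - ln (u * v) = F v - F u^-1.
    by rewrite /F lnM ?posrE// lnV ?posrE//; field.
  apply: (@area_strip _ u^-1 v (fun x => u - x^-1)).
  - by apply: measurableI => //; exact: measurableC.
  - exact: uv.
  - move=> -[x y] [[/= /andP[xu xv] /andP[yu yv] xy] /negP]; rewrite -leNgt/= => x0.
    rewrite (ltW xv) andbT; rewrite -(ler_pM2l u0) mulfV//; nra.
  - move=> x /andP[xl xr].
    have x0 : 0 < x by lra.
    have ux : 1 < u * x by rewrite -(mulfV uN) ltr_pM2l.
    rewrite (@xsection_interval _ x `[- u, - x^-1]).
      rewrite mu_itv; first by congr EFin; ring.
      by rewrite lerN2 -(ler_pM2l x0) mulfV ?gt_eqF//; lra.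
    move=> y; rewrite in_itv/=; split.
      case=> -[/= _ /andP[-> yv] xy] _ /=.
      by rewrite lerNr -(ler_pM2l x0) mulrN mulfV ?gt_eqF//; lra.
    move=> /andP[yu yx]; split; last by apply/negP; rewrite -leNgt ltW.
    have xy : x * y <= - 1.
      by move: yx; rewrite -(ler_pM2l x0) mulrN mulfV ?gt_eqF.
    have ? : y < 0 by nra.
    by split => /=; [rewrite xr; lra|rewrite yu/=; lra|lra].
  - move=> x /andP[xl xr]; have x0 : x != 0 by apply: lt0r_neq0; lra.
    by apply: ex_derive; apply: is_deriveB; apply: is_deriveV.
  - move=> x /andP[xl xr]; have x0 : 0 < x by lra.
    have := is_derive_ln x0 => ?.
    by apply: is_derive_eq; rewrite /GRing.scale/= mulr1.
by rewrite -EFinD; congr EFin; ring.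
Qed.

(** The quotient [(1 + v^2) / (1 - v^2)] is minus the secant of the angle at the vertex with tangent
    length [v]; [v = 1] is the right angle, where 0 is the limit. *)
Definition corner_term (v : R) : R :=
  if v == 1 then 0
  else 2 * (1 + v ^+ 2) / (1 - v ^+ 2) +
       2 * ((1 + v ^+ 2) / (1 - v ^+ 2)) ^+ 2 * ln v.

(** Each corner term occurs twice, for the two orders of the points; the [- 4 ln v] collects the
    logarithms of the two same-side areas that involve [v]. *)
Lemma psi_corner_term (v : R) : 0 < v -> psi (v ^- 2) = 2 * corner_term v - 4 * ln v.
Proof.
move=> v0; have vN : v != 0 by rewrite gt_eqF.
rewrite /psi /corner_term.
have -> : (v ^- 2 == 1) = (v == 1).
  by rewrite invr_eq1 sqrp_eq1 ?ltW.
case: eqVneq => [->|v1]; first by rewrite ln1 !mulr0 subrr.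
rewrite lnV ?posrE ?exprn_gt0// lnXn//.
have v2 : 1 - v ^+ 2 != 0.
  by rewrite subr_eq0 eq_sym sqrp_eq1 ?ltW.
have v2' : v ^+ 2 - 1 != 0 by rewrite -opprB oppr_eq0.
rewrite -mulr_natr; field.
by rewrite vN v2 v2'.
Qed.

(* The points with coordinates x and y on the two sides through a vertex are
   seen from the incenter under an obtuse angle. *)
Lemma area_adjacent_sides (u v w : R) : 0 < u -> 0 < v -> 0 < w ->
  u + v + w = u * v * w ->
  area [set z | [/\ - u <= z.1 < v, - v <= z.2 < w &
    (1 - v ^+ 2) * (1 + z.1 * z.2) + 2 * v * (z.1 - z.2) <= 0]] =
  (u * v + v * w + w * u - 1 + corner_term v)%:E.
Proof.
move=> u0 v0 w0 uvw; set S := [set z | _].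
have mS : measurable S.
  rewrite (_ : S = [set z | - u <= z.1] `&` [set z | z.1 < v] `&`
    [set z | - v <= z.2] `&` [set z | z.2 < w] `&`
    [set z | (1 - v ^+ 2) * (1 + z.1 * z.2) + 2 * v * (z.1 - z.2) <= 0]); last first.
    apply/seteqP; split => z /=; first by case=> /andP[-> ->] /andP[-> ->] ->.
    by case=> -[] [] [] a b c d e; split => //; apply/andP.
  apply: measurableI; last first.
    apply: measurable_le_set => //; apply: measurable_funD; apply: measurable_funM => //.
      by apply: measurable_funD => //; apply: measurable_funM.
    exact: measurable_funB.
  by repeat apply: measurableI; (exact: measurable_le_set || exact: measurable_lt_set).
(* At [x = - 1 / v] the common vertex, [y = - v], is seen under a right angle. Left of it every
   point of the other side qualifies; right of it the region lies above the graph of [y0]. *)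
have mT : measurable [set z : R * R | z.1 < - v^-1] by exact: measurable_lt_set.
have vN : v != 0 by rewrite gt_eqF.
have uv : 0 < u * v - 1.
  by rewrite -(pmulr_lgt0 _ w0); lra.
have vw : 0 < v * w - 1.
  by rewrite -(pmulr_rgt0 _ u0); lra.
have v1 : 0 < v^-1 by rewrite invr_gt0.
have vu : v^-1 <= u by rewrite -(ler_pM2r v0) mulVf//; lra.
have ltv x : (x < - v^-1) = (v * x < -1).
  by rewrite -(ltr_pM2l v0) mulrN mulfV.
have dE x : 2 * v - (1 - v ^+ 2) * x = (v * x + 1) * v + (v - x) by ring.
have d0 x : - v^-1 <= x <= v -> 0 < 2 * v - (1 - v ^+ 2) * x.
  move=> /andP[xl xr]; move: xl; rewrite leNgt ltv -leNgt => xl; rewrite dE.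
  have [xv|xv] := ltP x v; first by rewrite ltr_wpDl ?mulr_ge0//; lra.
  by rewrite ltr_pwDl// ?mulr_gt0//; nra.
rewrite (area_split mS mT).
have -> : area (S `&` [set z | z.1 < - v^-1]) = ((v + w) * (u - v^-1))%:E.
  pose F (x : R) := (v + w) * x.
  have -> : (v + w) * (u - v^-1) = F (- v^-1) - F (- u) by rewrite /F; ring.
  apply: (@area_strip _ (- u) (- v^-1) (fun x => v + w)).
  - exact: measurableI.
  - by rewrite lerN2.
  - by move=> -[x y] [[/= /andP[-> xv] _ _] /= x0]; rewrite ltW.
  - move=> x /andP[xl xr]; have xr' := xr; rewrite ltv in xr'.
    rewrite (@xsection_interval _ x `[- v, w[).
      by rewrite mu_itv; [congr EFin; ring|lra].
    move=> y; rewrite in_itv/=; split; first by case=> -[].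
    move=> /andP[yl yr]; split => //.
    split => /=; [by rewrite (ltW xl) (lt_trans xr)//; lra|by rewrite yl yr|].
    (* The condition is affine in [y], so it is checked at the ends [- v] and [w] and
       interpolated. *)
    have k1 : (1 - v ^+ 2) * (1 + x * - v) + 2 * v * (x - - v) <= 0.
      have -> : (1 - v ^+ 2) * (1 + x * - v) + 2 * v * (x - - v) =
        (1 + v ^+ 2) * (1 + v * x) by ring.
      by rewrite pmulr_rle0; [lra|rewrite ltr_wpDr ?sqr_ge0].
    have k2 : (1 - v ^+ 2) * (1 + x * w) + 2 * v * (x - w) <= 0.
      rewrite -(pmulr_rle0 _ uv).
      have wE : w = (u + v) / (u * v - 1).
        by apply: (mulIf (lt0r_neq0 uv)); rewrite divfK ?lt0r_neq0//; lra.
      have -> : (u * v - 1) * ((1 - v ^+ 2) * (1 + x * w) + 2 * v * (x - w)) =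
        - ((- 1 - v * x) * (u * v + v * w + w * u - 1) +
           (u + x) * ((1 + v ^+ 2) * (w + v))).
        by rewrite wE; field; rewrite lt0r_neq0.
      rewrite oppr_le0 addr_ge0// mulr_ge0//; [lra| |lra|].
        by have := mulr_gt0 w0 u0; lra.
      by rewrite mulr_ge0 ?addr_ge0 ?sqr_ge0// ltW.
    rewrite -(pmulr_rle0 _ (addr_gt0 v0 w0)).
    have -> : (v + w) * ((1 - v ^+ 2) * (1 + x * y) + 2 * v * (x - y)) =
      (w - y) * ((1 - v ^+ 2) * (1 + x * - v) + 2 * v * (x - - v)) +
      (y + v) * ((1 - v ^+ 2) * (1 + x * w) + 2 * v * (x - w)) by ring.
    by rewrite -oppr_ge0 opprD -!mulrN addr_ge0// mulr_ge0 ?oppr_ge0//; lra.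
  - by move=> x _; exact: ex_derive.
  - by move=> x _; apply: is_derive_eq; rewrite /GRing.scale/= mulr1.
pose y0 x := ((1 - v ^+ 2) + 2 * v * x) / (2 * v - (1 - v ^+ 2) * x).
(* A primitive of [y0]. For [v = 1] the hyperbola degenerates to the line [y0 x = x]. *)
pose G x := if v == 1 then x ^+ 2 / 2 else
  - (2 * v / (1 - v ^+ 2)) * x -
    ((1 + v ^+ 2) / (1 - v ^+ 2)) ^+ 2 * ln (2 * v - (1 - v ^+ 2) * x).
have v21 : v != 1 -> 1 - v ^+ 2 != 0.
  by move=> ?; rewrite subr_eq0 eq_sym sqrp_eq1 ?ltW.
have GE : G v - G (- v^-1) = - corner_term v.
  rewrite /G /corner_term; case: eqVneq => [->|vn1].
    by rewrite invr1 sqrrN !expr1n subrr oppr0.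
  have -> : 2 * v - (1 - v ^+ 2) * v = v * (1 + v ^+ 2) by ring.
  have -> : 2 * v - (1 - v ^+ 2) * - v^-1 = v^-1 * (1 + v ^+ 2) by field.
  rewrite !lnM ?lnV ?posrE//; [|by rewrite ltr_wpDr ?sqr_ge0..].
  by field; rewrite vN v21.
have -> : area (S `&` ~` [set z | z.1 < - v^-1]) =
    (w * (v + v^-1) + corner_term v)%:E.
  pose F (x : R) := w * x - G x.
  have -> : w * (v + v^-1) + corner_term v = F v - F (- v^-1).
    by rewrite -[corner_term v]opprK -GE /F; ring.
  apply: (@area_strip _ (- v^-1) v (fun x => w - y0 x)).
  - by apply: measurableI => //; exact: measurableC.
  - lra.
  - by move=> -[x y] [[/= /andP[_ xv] _ _] /negP /=]; rewrite -leNgt => ->; rewrite ltW.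
  - move=> x /andP[xl xr].
    have D0 : 0 < 2 * v - (1 - v ^+ 2) * x by apply: d0; rewrite !ltW.
    have xl' : -1 <= v * x by move: (ltW xl); rewrite leNgt ltv -leNgt.
    have y0l : - v <= y0 x.
      rewrite ler_pdivlMr// -subr_ge0.
      have -> : 1 - v ^+ 2 + 2 * v * x - - v * (2 * v - (1 - v ^+ 2) * x) =
        (1 + v ^+ 2) * (v * x + 1) by ring.
      by apply: mulr_ge0; [rewrite addr_ge0 ?sqr_ge0|lra].
    have y0r : y0 x <= w.
      rewrite ler_pdivrMr// -subr_ge0.
      have -> : w * (2 * v - (1 - v ^+ 2) * x) - (1 - v ^+ 2 + 2 * v * x) =
        (v * x + 1) * (v * w - 1) + (v - x) * (v + w) by ring.
      by apply: addr_ge0; apply: mulr_ge0; lra.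
    rewrite (@xsection_interval _ x `[y0 x, w[); first by rewrite mu_itv.
    have key y : ((1 - v ^+ 2) * (1 + x * y) + 2 * v * (x - y) <= 0) = (y0 x <= y).
      by rewrite ler_pdivrMr// -[RHS]subr_le0; congr (_ <= _); ring.
    move=> y; rewrite in_itv/=; split.
      by case=> -[/= _ /andP[_ ->]]; rewrite key => ->.
    move=> /andP[yl yr]; split; last by apply/negP; rewrite -leNgt ltW.
    split => /=; [|by rewrite yr (le_trans y0l)|by rewrite key].
    by rewrite xr andbT; lra.
  - move=> x xvv; have D0 := d0 _ xvv.
    have dD : is_derive x 1 (fun x : R => 2 * v - (1 - v ^+ 2) * x) (- (1 - v ^+ 2)).
      by apply: is_derive_eq; rewrite /GRing.scale/=; ring.
    have dV : is_derive x 1 (fun t : R => (2 * v - (1 - v ^+ 2) * t)^-1)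
        (- (2 * v - (1 - v ^+ 2) * x) ^- 2 *: - (1 - v ^+ 2)).
      by apply: (@is_deriveV R (fun t => 2 * v - (1 - v ^+ 2) * t)); rewrite ?gt_eqF.
    have dN : is_derive x 1 (fun t : R => 1 - v ^+ 2 + 2 * v * t) (2 * v).
      by apply: is_derive_eq; rewrite /GRing.scale/=; ring.
    by apply: ex_derive; apply: is_deriveB; apply: (is_deriveM dN dV).
  - move=> x xvv; have D0 := d0 _ xvv.
    have DN : 2 * v - (1 - v ^+ 2) * x != 0 by rewrite gt_eqF.
    have dD : is_derive x 1 (fun x : R => 2 * v - (1 - v ^+ 2) * x) (- (1 - v ^+ 2)).
      by apply: is_derive_eq; rewrite /GRing.scale/=; ring.
    have dG : is_derive x 1 G (y0 x).
      rewrite /G; case: eqVneq => [v1'|vn1].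
        rewrite /y0 v1'; apply: is_derive_eq.
        by rewrite /GRing.scale/= expr1n subrr mul0r subr0 mulr1 add0r; field.
      have ? := @is_derive_ln_comp R (fun x => 2 * v - (1 - v ^+ 2) * x) x _ D0 dD.
      apply: is_derive_eq; rewrite /y0 /GRing.scale/=; field.
      by rewrite DN v21.
    by apply: is_derive_eq; rewrite /GRing.scale/= mulr1.
by rewrite -EFinD; congr EFin; field.
Qed.

End PlaneArea.

(** * Linear changes of variables *)

Section LinearChange.
Context {R : realType}.
Implicit Types (S : set (R * R)).
Local Notation mu := (@lebesgue_measure R).

Lemma image_measure d d' (X : measurableType d) (Y : measurableType d')
    (m : {measure set X -> \bar R}) (f : X -> Y) : measurable_fun setT f ->
  exists m' : {measure set Y -> \bar R}, forall A, m' A = m (f @^-1` A).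
Proof.
by move=> mf; unshelve eexists (pushforward m f).
Qed.

(** Uniqueness of Lebesgue measure from half-open intervals; for [a < 0] the preimage is half-open
    at the other end, with the same length. *)
Lemma lebesgue_measure_affine (a b : R) (A : set R) : a != 0 -> measurable A ->
  mu ((fun x => a * x + b) @^-1` A) = (`|a|^-1%:E * mu A)%E.
Proof.
move=> a0 mA.
have mf : measurable_fun [set: measurableTypeR R] (fun x : R => a * x + b : measurableTypeR R).
  by apply: measurable_funD => //; exact: measurable_funM.
have [m mE] := @image_measure _ _ _ _ mu _ mf.
have an : 0 < `|a| by rewrite normr_gt0.
have msE X : mscale (`|a|%:nng) m X = (`|a|%:E * mu ((fun x : R => (a * x + b)%R) @^-1` X))%E.
  by rewrite -mE.
have key : forall A, measurable A -> mu A = mscale (`|a|%:nng) m A.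
  apply: lebesgue_measure_unique => _ [[c d]] _ <-.
  apply: (etrans _ (esym (msE _))).
  move: a0; rewrite neq_lt => /orP[a0|a0].
    rewrite (_ : _ @^-1` _ = `[(d - b) / a, (c - b) / a[%classic); last first.
      apply/seteqP; split => x /=; rewrite !in_itv/= ler_ndivrMr// ltr_ndivlMr//; lra.
    rewrite !lebesgue_measure_itv/= !lte_fin ltr_ndivrMr// divfK ?lt_eqF// ltrD2r.
    case: ifP => _; rewrite ?mule0// ltr0_norm// -!EFinB -EFinM; congr EFin; field.
    by rewrite lt_eqF.
  rewrite (_ : _ @^-1` _ = `](c - b) / a, (d - b) / a]%classic); last first.
    apply/seteqP; split => x /=; rewrite !in_itv/= ler_pdivlMr// ltr_pdivrMr//; lra.
  rewrite !lebesgue_measure_itv/= !lte_fin ltr_pdivlMr// divfK ?gt_eqF// ltrD2r.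
  case: ifP => _; rewrite ?mule0// gtr0_norm// -!EFinB -EFinM; congr EFin; field.
  by rewrite gt_eqF.
by rewrite (etrans (key A mA) (msE A)) muleA -EFinM mulVf ?gt_eqF// mul1e.
Qed.

Lemma integral_affine (a b : R) (g : R -> \bar R) : a != 0 ->
  measurable_fun setT g -> (forall x, 0 <= g x)%E ->
  (\int[mu]_x g (a * x + b)%R = `|a|^-1%:E * \int[mu]_x g x)%E.
Proof.
move=> a0 mg g0.
have mf : measurable_fun [set: measurableTypeR R] (fun x : R => a * x + b : measurableTypeR R).
  by apply: measurable_funD => //; exact: measurable_funM.
have an : 0 <= `|a|^-1 by rewrite invr_ge0.
have := @ge0_integral_pushforward _ _ _ _ _ _ mf mu setT g measurableT mg.
move=> /(_ (fun x _ => g0 x)) /= => <-.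
rewrite (eq_measure_integral (mscale (NngNum an) mu)); last first.
  by move=> A mA _; rewrite /mscale/= /pushforward lebesgue_measure_affine.
by rewrite ge0_integral_mscale.
Qed.

Let area_lower (a c d e f : R) S : a != 0 -> d != 0 -> measurable S ->
  area ((fun z => (a * z.1 + e, c * z.1 + d * z.2 + f)) @^-1` S) =
  (`|a * d|^-1%:E * area S)%E.
Proof.
move=> a0 d0 mS; rewrite !areaE normrM invfM EFinM -muleA (muleC `|d|^-1%:E) muleA.
have mx : measurable_fun setT (fun x => mu (xsection S x)) by exact: measurable_fun_xsection.
rewrite -(integral_affine e a0 mx)// muleC -ge0_integralZl ?lee_fin ?invr_ge0//; last first.
  apply: (measurableT_comp mx); apply: measurable_funD => //; exact: measurable_funM.
apply: eq_integral => x _.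
rewrite -(lebesgue_measure_affine (c * x + f) d0); last exact: measurable_xsection.
congr (mu _).
have eE y : c * x + d * y + f = d * y + (c * x + f) by ring.
by apply/seteqP; split => y; rewrite /xsection/= !inE/= eE.
Qed.

Let area_swap S : measurable S -> area (@unstable.swap R R @^-1` S) = area S.
Proof.
move=> mS.
have ms : measurable_fun [set: measurableTypeR R * measurableTypeR R] unstable.swap.
  exact: measurable_swap.
have [m mE] := image_measure (mu \x mu)%E ms.
rewrite -[LHS](mE S); apply/esym; rewrite /area; apply: product_measure_unique => //.
move=> A B mA mB; rewrite mE (_ : _ @^-1` _ = B `*` A); last first.
  by apply/seteqP; split => -[x y] [].
exact: (etrans (product_measure1E mu mu mB mA) (muleC _ _)).
Qed.

Let measurable_affine2 (a b c d e f : R) : measurable_fun setT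
  (fun z : R * R => (a * z.1 + b * z.2 + e, c * z.1 + d * z.2 + f)).
Proof. by apply: measurable_fun_pair; exact: measurable_affine. Qed.

Let preimage_affine2 (a b c d e f : R) S : measurable S -> measurable
  ((fun z : R * R => (a * z.1 + b * z.2 + e, c * z.1 + d * z.2 + f)) @^-1` S).
Proof. by move=> mS; rewrite -[X in measurable X]setTI; exact: measurable_affine2. Qed.

Let preimage_swap S : measurable S -> measurable (@unstable.swap R R @^-1` S).
Proof. by move=> mS; rewrite -[X in measurable X]setTI; exact: measurable_swap. Qed.

(** For [d != 0] the map is a lower triangular map followed by a horizontal shear, and the shear is
    a lower triangular map conjugated by the swap. For [d = 0] the two output coordinates are
    exchanged first. *)
Lemma area_affine (a b c d e f : R) S : a * d - b * c != 0 -> measurable S ->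
  area ((fun z => (a * z.1 + b * z.2 + e, c * z.1 + d * z.2 + f)) @^-1` S) =
  (`|a * d - b * c|^-1%:E * area S)%E.
Proof.
move: a b c d e f S.
have nz (a b c d e f : R) S : a * d - b * c != 0 -> d != 0 -> measurable S ->
  area ((fun z => (a * z.1 + b * z.2 + e, c * z.1 + d * z.2 + f)) @^-1` S) =
  (`|a * d - b * c|^-1%:E * area S)%E.
  move=> det d0 mS.
  pose U (z : R * R) := (z.1 + b / d * z.2 + (e - b / d * f), z.2).
  pose U' (z : R * R) := (1 * z.1 + 0, b / d * z.1 + 1 * z.2 + (e - b / d * f)).
  pose V (z : R * R) := ((a * d - b * c) / d * z.1 + 0, c * z.1 + d * z.2 + f).
  have UE : U @^-1` S = @unstable.swap R R @^-1` (U' @^-1` (@unstable.swap R R @^-1` S)).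
    suff -> : U = @unstable.swap R R \o U' \o @unstable.swap R R by [].
    by apply/funext => -[x y]; rewrite /U /U' /unstable.swap /=; congr pair; ring.
  rewrite (_ : (fun _ => _) = U \o V); last first.
    by apply/funext => -[x y]; rewrite /U /V /=; congr pair; field.
  rewrite comp_preimage.
  have mU' : measurable (U' @^-1` (@unstable.swap R R @^-1` S)).
    have := @preimage_affine2 1 0 (b / d) 1 0 (e - b / d * f) _ (preimage_swap mS).
    rewrite (_ : (fun _ => _) = U') //.
    by apply/funext => -[x y]; rewrite /U' /=; congr pair; ring.
  have mU : measurable (U @^-1` S) by rewrite UE; exact: preimage_swap.
  rewrite area_lower//; last by rewrite mulf_neq0 ?invr_eq0.
  rewrite divfK// UE area_swap// area_lower ?oner_eq0//; last exact: preimage_swap.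
  by rewrite area_swap// mulr1 normr1 invr1 mul1e.
move=> a b c d e f S det mS; have [d0|d0] := eqVneq d 0; last exact: nz.
subst d.
have b0 : b != 0 by apply: contraNneq det => ->; rewrite mulr0 mul0r subrr.
have c0 : c != 0 by apply: contraNneq det => ->; rewrite !mulr0 subrr.
rewrite (_ : _ @^-1` _ =
    (fun z => (c * z.1 + 0 * z.2 + f, a * z.1 + b * z.2 + e)) @^-1`
    (@unstable.swap R R @^-1` S)); last by apply/seteqP; split => -[x y].
rewrite nz ?mul0r ?subr0 ?mulf_neq0//; last exact: preimage_swap.
by rewrite area_swap// mulr0 sub0r normrN mulrC.
Qed.

End LinearChange.

(** * Cones and joint laws *)

Section ConeLaw.
Context {R : realType}.
Implicit Types (S : set (R * R)) (A J : set R).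
Local Notation mu := (@lebesgue_measure R).

Lemma measurable_inv : measurable_fun [set: R] (@GRing.inv R).
Proof.
rewrite -(setUv [set (0 : R)]); apply/measurable_funU => //.
  exact: measurableC.
split; first exact: measurable_fun_set1.
apply: open_continuous_measurable_fun.
  by rewrite openC; apply: closed_eq.
by move=> x; rewrite inE/= => /eqP x0; exact: inv_continuous.
Qed.

Lemma area_unit_cone J : measurable J ->
  area [set z | 0 < z.1 < 1 /\ J (z.2 / z.1)] = (2^-1%:E * mu J)%E.
Proof.
move=> mJ; rewrite areaE.
transitivity (\int[mu]_(x in `]0%R, 1%R[) (mu J * x%:E))%E.
  rewrite [RHS]integral_mkcond; apply: eq_integral => x _; rewrite patchE.
  case: ifPn => [|/negP x01].
    rewrite inE/= in_itv/= => x01; have /andP[x0 x1] := x01.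
    have xi : x^-1 != 0 by rewrite invr_eq0 gt_eqF.
    rewrite (_ : xsection _ _ = (fun y => x^-1 * y + 0) @^-1` J); last first.
      apply/seteqP; split => y; rewrite /xsection/= inE/= addr0 (mulrC _ y).
        by case.
      by move=> h; split.
    rewrite lebesgue_measure_affine// muleC normfV invrK gtr0_norm//.
  rewrite (_ : xsection _ _ = set0) ?measure0//.
  apply/seteqP; split => // y; rewrite /xsection/= inE/= => -[h _].
  by apply: x01; rewrite inE/= in_itv.
rewrite ge0_integralZl//; last first.
  by move=> x; rewrite /= in_itv/= => /andP[x0 _]; rewrite lee_fin ltW.
rewrite muleC; congr (_ * _)%E.
rewrite -(@integral_itv_bndoo _ 0 1 _ true false)//.
have cF (t : R) : {for t, continuous (fun x : R => x ^+ 2 / 2)}.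
  by apply/differentiable_continuous/derivable1_diffP; exact: ex_derive.
rewrite (@continuous_FTC2 _ id (fun x => x ^+ 2 / 2) 0 1)//.
- by rewrite expr0n expr1n/= mul0r mul1r -EFinB subr0.
- by apply: continuous_subspaceT => x; exact: cvg_id.
- split.
  + by move=> x _; exact: ex_derive.
  + by apply: cvg_at_right_filter; exact: cF.
  + by apply: cvg_at_left_filter; exact: cF.
- move=> x _; rewrite derive1E; apply: derive_val.
  by apply: is_derive_eq; rewrite /GRing.scale/=; field.
Qed.

Lemma area_cone (a b c d e f : R) J : a * d - b * c != 0 -> measurable J ->
  area [set z | 0 < a * z.1 + b * z.2 + e < 1 /\
               J ((c * z.1 + d * z.2 + f) / (a * z.1 + b * z.2 + e))] =
  ((`|a * d - b * c|^-1 / 2)%:E * mu J)%E.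
Proof.
move=> det mJ.
have mC : measurable [set z : R * R | 0 < z.1 < 1 /\ J (z.2 / z.1)].
  rewrite (_ : [set z | _] = [set z | 0 < z.1] `&` [set z | z.1 < 1] `&`
    ((fun z : R * R => z.2 / z.1) @^-1` J)); last first.
    apply/seteqP; split => z /=; first by case=> /andP[-> ->].
    by case=> -[-> ->].
  apply: measurableI; first by apply: measurableI; exact: measurable_lt_set.
  rewrite -[X in measurable X]setTI.
  have : measurable_fun setT (fun z : R * R => z.2 / z.1).
    by apply: measurable_funM => //; exact: (measurableT_comp measurable_inv).
  exact.
have := area_affine e f det mC; rewrite area_unit_cone// muleA -EFinM => <-.
by [].
Qed.

End ConeLaw.

Section JointLaw.
Context {R : realType} {d : measure_display} {Omega : measurableType d}.
Variable Pr : probability Omega R.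
Variables P Q : {RV Pr >-> (R * R)%type}.
Hypothesis hPQ : independent P Q.
Local Notation mu := (@lebesgue_measure R).

(** The laws are known only on the events [C] and [D], so [Pr] is restricted to them and pushed to
    the plane. By independence the result agrees with the scaled restricted area on rectangles, a
    generating family stable under intersection. *)
Lemma joint_law (C D : set (R * R)) (x y : R * R -> R) (I J : set R) (k : R) :
  0 <= k ->
  measurable C -> measurable D -> measurable_fun setT x -> measurable_fun setT y ->
  measurable I -> measurable J ->
  (forall A, measurable A ->
    Pr (P @^-1` (C `&` x @^-1` A)) = (k%:E * mu (A `&` I))%E) ->
  (forall B, measurable B ->
    Pr (Q @^-1` (D `&` y @^-1` B)) = (k%:E * mu (B `&` J))%E) ->
  forall H : set (R * R), measurable H ->
  Pr [set w | [/\ C (P w), D (Q w) & H (x (P w), y (Q w))]] =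
  ((k * k)%:E * area (H `&` (I `*` J)))%E.
Proof.
move=> k0 mC mD mx my mI mJ lawP lawQ H mH.
have mP S : measurable S -> measurable (P @^-1` S).
  by move=> mS; rewrite -[X in measurable X]setTI; exact: measurable_funP.
have mQ S : measurable S -> measurable (Q @^-1` S).
  by move=> mS; rewrite -[X in measurable X]setTI; exact: measurable_funP.
have mE : measurable (P @^-1` C `&` Q @^-1` D) by apply: measurableI; auto.
have mxy : measurable_fun [set: Omega] (fun w => (x (P w), y (Q w)) : measurableTypeR R * measurableTypeR R).
  by apply: measurable_fun_pair; exact: measurableT_comp.
have [m mEq] := image_measure (mrestr Pr mE) mxy.
have mIJ : measurable (I `*` J) by exact: measurableX.
have kk : 0 <= k * k by exact: mulr_ge0.
transitivity (m H).
  rewrite mEq /mrestr; congr (Pr _); apply/seteqP; split => w /=.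
    by case.
  by case=> ? [].
pose m' : {measure set (measurableTypeR R * measurableTypeR R) -> \bar R} :=
  mscale (NngNum kk) (mrestr (mu \x mu)%E mIJ).
transitivity (m' H); last by [].
pose G : set (set (measurableTypeR R * measurableTypeR R)) :=
  [set A `*` B | A in measurable & B in measurable].
apply: (@measure_unique _ R (measurableTypeR R * measurableTypeR R)%type G (fun _ => setT) _ _ _ _ m m') => //.
- by rewrite measurable_prod_measurableType.
- move=> _ _ [A mA [B mB <-]] [A' mA' [B' mB' <-]].
  by rewrite -setXI; exists (A `&` A'); [exact: measurableI|exists (B `&` B') => //; exact: measurableI].
- by move=> _; exists setT => //; exists setT => //; rewrite setXTT.
- by rewrite bigcup_const//; exists 0%N.
- move=> _ [A mA [B mB <-]].
  have -> : m' (A `*` B) =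
      ((k * k)%:E * (mu \x mu)%E ((A `&` I) `*` (B `&` J)))%E.
    by rewrite setXI.
  rewrite mEq /mrestr.
  have -> : (mu \x mu)%E ((A `&` I) `*` (B `&` J)) = (mu (A `&` I) * mu (B `&` J))%E.
    by apply: product_measure1E; exact: measurableI.
  transitivity (Pr (P @^-1` (C `&` x @^-1` A) `&` Q @^-1` (D `&` y @^-1` B))).
    congr (Pr _); apply/seteqP; split => w /=; last by case=> -[? ?] [].
    by case=> -[? ?] [].
  have mxA : measurable (x @^-1` A) by rewrite -[X in measurable X]setTI; exact: mx.
  have myB : measurable (y @^-1` B) by rewrite -[X in measurable X]setTI; exact: my.
  rewrite hPQ ?lawP ?lawQ//; [|exact: measurableI..].
  by rewrite EFinM muleACA.
- move=> _; rewrite mEq /mrestr.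
  apply: le_lt_trans (ltry 1).
  apply: probability_le1; apply: measurableI => //; rewrite preimage_setT; exact: measurableT.
Qed.

End JointLaw.

(** * The incircle *)

Section Contact.
Context {R : realType}.
Implicit Types A B C I N T X Y Z : R * R.

Local Notation edist := Defs.edist.

Definition dot X Y : R := X.1 * Y.1 + X.2 * Y.2.

Lemma pair_ext X Y : X.1 = Y.1 -> X.2 = Y.2 -> X = Y.
Proof. by case: X Y => ? ? [? ?]/= -> ->. Qed.

Lemma collinearP X Y Z :
  (Y.1 - X.1) * (Z.2 - X.2) = (Y.2 - X.2) * (Z.1 - X.1) -> collinear X Y Z.
Proof.
move=> d0.
have key (a b c : R) : (a, b) <> (0, 0) -> a * X.1 + b * X.2 = c ->
    a * Y.1 + b * Y.2 = c -> a * Z.1 + b * Z.2 = c -> collinear X Y Z.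
  move=> ab hX hY hZ; exists a, b, c; split => // P.
  by rewrite !inE => /or3P[] /eqP ->.
have [xy|xy] := eqVneq X Y; last first.
  apply: (key (- (Y.2 - X.2)) (Y.1 - X.1)
    (- (Y.2 - X.2) * X.1 + (Y.1 - X.1) * X.2)) => //; [|ring|lra].
  move=> [/eqP]; rewrite oppr_eq0 subr_eq0 => /eqP e2 /eqP; rewrite subr_eq0 => /eqP e1.
  by move/eqP: xy; apply; case: X Y e1 e2 {d0 key} => ? ? [? ?]/= -> ->.
subst Y; have [xz|xz] := eqVneq X Z.
  subst Z; apply: (key 1 0 X.1) => //; [|ring..].
  by move=> [/eqP]; rewrite oner_eq0.
apply: (key (- (Z.2 - X.2)) (Z.1 - X.1)
    (- (Z.2 - X.2) * X.1 + (Z.1 - X.1) * X.2)) => //; [|ring].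
move=> [/eqP]; rewrite oppr_eq0 subr_eq0 => /eqP e2 /eqP; rewrite subr_eq0 => /eqP e1.
by move/eqP: xz; apply; case: X Z e1 e2 {d0 key} => ? ? [? ?]/= -> ->.
Qed.

Lemma edist_ge0 X Y : 0 <= edist X Y.
Proof. exact: sqrtr_ge0. Qed.

Lemma edist_sqr X Y : edist X Y ^+ 2 = (X.1 - Y.1) ^+ 2 + (X.2 - Y.2) ^+ 2.
Proof. by rewrite sqr_sqrtr// addr_ge0 ?sqr_ge0. Qed.

Lemma edist_le X Y (r : R) : 0 <= r ->
  (edist X Y <= r) = ((X.1 - Y.1) ^+ 2 + (X.2 - Y.2) ^+ 2 <= r ^+ 2).
Proof.
by move=> r0; rewrite -edist_sqr ler_sqr ?nnegrE// edist_ge0.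
Qed.

(* An affine form vanishing on the side is nonnegative on the triangle, hence
   on the disk, and it vanishes at the contact point: the radius to that point
   minimizes the form on the disk and is normal to the side. *)
Lemma contact_normal X Y Z I (r : R) P : 0 < r ->
  edisk I r `<=` triangle X Y Z -> ~ collinear X Y Z ->
  edist I P = r -> segment X Y P -> dot (P - I) (Y - X) = 0.
Proof.
move=> r0 disk col IP [s [s01 PE]].
pose e1 := Y.1 - X.1; pose e2 := Y.2 - X.2.
pose d := e1 * (Z.2 - X.2) - e2 * (Z.1 - X.1).
have d0 : d != 0.
  by apply/eqP => /eqP; rewrite subr_eq0 => /eqP /collinearP.
(* The factor [d], twice the signed area, makes the form nonnegative on the triangle for either
   orientation. *)
pose m1 := - d * e2; pose m2 := d * e1.
have f_ge0 V : triangle X Y Z V -> 0 <= m1 * (V.1 - X.1) + m2 * (V.2 - X.2).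
  move=> [a [b [c [a0 b0 c0 abc ->]]]] /=.
  have -> : a = 1 - b - c by lra.
  rewrite /GRing.scale/=.
  have -> : m1 * ((1 - b - c) * X.1 + b * Y.1 + c * Z.1 - X.1) +
     m2 * ((1 - b - c) * X.2 + b * Y.2 + c * Z.2 - X.2) = c * d ^+ 2.
    by rewrite /m1 /m2 /d /e1 /e2; ring.
  by rewrite mulr_ge0 ?sqr_ge0.
have P1 : P.1 = X.1 + s * e1 by rewrite PE /= /GRing.scale/= /e1; ring.
have P2 : P.2 = X.2 + s * e2 by rewrite PE /= /GRing.scale/= /e2; ring.
have rr : (I.1 - P.1) ^+ 2 + (I.2 - P.2) ^+ 2 = r ^+ 2 by rewrite -IP edist_sqr.
pose M := m1 ^+ 2 + m2 ^+ 2.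
have ME : M = d ^+ 2 * (e1 ^+ 2 + e2 ^+ 2) by rewrite /M /m1 /m2; ring.
have d20 : 0 < d ^+ 2 by rewrite exprn_even_gt0.
have e0 : 0 < e1 ^+ 2 + e2 ^+ 2.
  rewrite lt_def addr_ge0 ?sqr_ge0// andbT paddr_eq0 ?sqr_ge0// !sqrf_eq0.
  by apply: contra d0 => /andP[/eqP h1 /eqP h2]; rewrite /d h1 h2 !mul0r subrr.
have M0 : 0 < M by rewrite ME mulr_gt0.
pose k := Num.sqrt M.
have k0 : 0 < k by rewrite sqrtr_gt0.
have kk : k ^+ 2 = M by rewrite sqr_sqrtr// ltW.
have kN : k != 0 by rewrite gt_eqF.
have : 0 <= m1 * (I.1 - r / k * m1 - X.1) + m2 * (I.2 - r / k * m2 - X.2).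
  apply: (f_ge0 (I.1 - r / k * m1, I.2 - r / k * m2)); apply: disk.
  rewrite /edisk/= edist_le ?(ltW r0)//=.
  have -> : (I.1 - (I.1 - r / k * m1)) ^+ 2 + (I.2 - (I.2 - r / k * m2)) ^+ 2 =
    (r / k) ^+ 2 * M by rewrite /M; ring.
  by rewrite -kk exprMn exprVn divfK// expf_neq0.
have -> : m1 * (I.1 - r / k * m1 - X.1) + m2 * (I.2 - r / k * m2 - X.2) =
  m1 * (I.1 - P.1) + m2 * (I.2 - P.2) - r / k * M.
  by rewrite P1 P2 /M /m1 /m2; ring.
rewrite -kk expr2 mulrA divfK// => ge.
have cs : (m1 * (I.1 - P.1) + m2 * (I.2 - P.2)) ^+ 2 +
    (d * dot (P - I) (Y - X)) ^+ 2 = (r * k) ^+ 2.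
  rewrite [RHS]exprMn kk -rr /M /m1 /m2 /dot /= -/e1 -/e2; ring.
have ge2 : (r * k) ^+ 2 <= (m1 * (I.1 - P.1) + m2 * (I.2 - P.2)) ^+ 2.
  by rewrite ler_sqr ?nnegrE; [lra|rewrite mulr_ge0// ltW|
    have := mulr_gt0 r0 k0; lra].
have : (d * dot (P - I) (Y - X)) ^+ 2 <= 0 by lra.
rewrite real_exprn_even_le0 ?num_real//= => /eqP/eqP; rewrite mulf_eq0 (negbTE d0)/=.
by move/eqP.
Qed.

(** [N] is the radius to the contact point and [T] the direction of the side scaled to the same
    length, so [a] and [b] are the tangent lengths in the unit of the inradius. *)
Lemma contact_side X Y Z I (r : R) : 0 < r ->
  edisk I r `<=` triangle X Y Z -> ~ collinear X Y Z -> tangent_to_side I r X Y ->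
  exists N T (a b : R), [/\ dot N N = r ^+ 2, dot T T = r ^+ 2 & dot N T = 0] /\
    [/\ 0 <= a, 0 <= b, X = I + N - a *: T & Y = I + N + b *: T].
Proof.
move=> r0 disk col [P TP].
have [IP sP] : edist I P = r /\ segment X Y P.
  by have : [set P] P by []; rewrite -TP => -[].
have := contact_normal r0 disk col IP sP.
have [s [/andP[s0 s1] PE]] := sP => NT.
pose e := edist X Y.
have e0 : 0 < e.
  rewrite lt_def edist_ge0 andbT; apply/eqP => e0; apply: col; apply: collinearP.
  have := edist_sqr X Y; rewrite -/e e0 expr0n/= => /esym/eqP.
  rewrite paddr_eq0 ?sqr_ge0// !sqrf_eq0 !subr_eq0 => /andP[/eqP -> /eqP ->].
  by rewrite !subrr !mul0r.
have eN : e != 0 by rewrite gt_eqF.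
have rN : r != 0 by rewrite gt_eqF.
exists (P - I), ((r / e) *: (Y - X)), (s * e / r), ((1 - s) * e / r); split; split.
- by rewrite -IP edist_sqr /dot/=; ring.
- rewrite /dot/= /GRing.scale/=.
  transitivity (r ^+ 2 / e ^+ 2 * ((X.1 - Y.1) ^+ 2 + (X.2 - Y.2) ^+ 2)).
    by move: e eN {e0} => e eN; field.
  by rewrite -edist_sqr divfK ?expf_neq0.
- move: NT; rewrite /dot/= /GRing.scale/= => NT.
  transitivity (r / e * ((P.1 - I.1) * (Y.1 - X.1) + (P.2 - I.2) * (Y.2 - X.2))).
    by ring.
  by rewrite NT mulr0.
- by rewrite divr_ge0 ?mulr_ge0// ltW.
- by rewrite divr_ge0 ?mulr_ge0 ?subr_ge0// ltW.
- rewrite scalerA (_ : s * e / r * (r / e) = s); last by move: e eN {e0} => e eN; field; rewrite eN rN.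
  rewrite PE; case: (X) (Y) (I) => [x1 x2] [y1 y2] [i1 i2] /=.
  by congr pair => /=; rewrite /GRing.scale/=; ring.
- rewrite scalerA (_ : (1 - s) * e / r * (r / e) = 1 - s); last by move: e eN {e0} => e eN; field; rewrite eN rN.
  rewrite PE; case: (X) (Y) (I) => [x1 x2] [y1 y2] [i1 i2] /=.
  by congr pair => /=; rewrite /GRing.scale/=; ring.
Qed.

(** By Lagrange's identity the cross product of the two vectors is [rho] or [- rho]; each sign turns
    a sum of two squares into 0. *)
Lemma orthogonal_rotation n1 n2 t1 t2 (rho : R) : n1 * n1 + n2 * n2 = rho -> t1 * t1 + t2 * t2 = rho ->
  n1 * t1 + n2 * t2 = 0 -> (t1 = - n2 /\ t2 = n1) \/ (t1 = n2 /\ t2 = - n1).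
Proof.
move=> nn tt nt.
have : (n1 * t2 - n2 * t1 - rho) * (n1 * t2 - n2 * t1 + rho) = 0.
  have : (n1 * n1 + n2 * n2) * (t1 * t1 + t2 * t2) - (n1 * t1 + n2 * t2) ^+ 2 = rho ^+ 2.
    by rewrite nn tt nt expr0n/= subr0.
  lra.
have z x y : x ^+ 2 + y ^+ 2 = 0 -> x = 0 /\ y = 0 :> R.
  move/eqP; rewrite paddr_eq0 ?sqr_ge0// !sqrf_eq0 => /andP[/eqP -> /eqP ->].
  by [].
move/eqP; rewrite mulf_eq0 => /orP[/eqP h|/eqP h]; [left|right].
  have [|? ?] := z (t1 + n2) (t2 - n1); [lra|split; lra].
have [|? ?] := z (t1 - n2) (t2 + n1); [lra|split; lra].
Qed.

(** In complex notation [N (1 + i v) = P (1 - i v)] is solved for [P]. *)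
Let turn (v n1 n2 p1 p2 : R) : n1 - v * n2 = p1 + v * p2 -> n2 + v * n1 = p2 - v * p1 ->
  p1 = ((1 - v ^+ 2) * n1 - 2 * v * n2) / (1 + v ^+ 2) /\
  p2 = ((1 - v ^+ 2) * n2 + 2 * v * n1) / (1 + v ^+ 2).
Proof.
move=> e1 e2; have v1 : 1 + v ^+ 2 != 0 by rewrite gt_eqF// ltr_wpDr ?sqr_ge0.
have f1 := congr1 ( *%R v) e1; have f2 := congr1 ( *%R v) e2.
by split; apply: (mulIf v1); rewrite divfK//; lra.
Qed.

Let same (v n1 n2 p1 p2 : R) : n1 - v * n2 = p1 - v * p2 -> n2 + v * n1 = p2 + v * p1 ->
  n1 = p1 /\ n2 = p2.
Proof.
move=> e1 e2; have v1 : 1 + v ^+ 2 != 0 by rewrite gt_eqF// ltr_wpDr ?sqr_ge0.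
have f1 := congr1 ( *%R v) e1; have f2 := congr1 ( *%R v) e2.
by split; apply: (mulIf v1); lra.
Qed.

(* The two contact points seen from a vertex are mirror images in the bisector. *)
Lemma contact_turn N T N' T' (rho v v' : R) : 0 < rho -> 0 <= v -> 0 <= v' ->
  dot N N = rho -> dot T T = rho -> dot N T = 0 ->
  dot N' N' = rho -> dot T' T' = rho -> dot N' T' = 0 ->
  N + v *: T = N' - v' *: T' -> N <> N' ->
  [/\ v' = v, 0 < v, N' = ((1 - v ^+ 2) / (1 + v ^+ 2)) *: N + (2 * v / (1 + v ^+ 2)) *: T &
      T' = (- (2 * v) / (1 + v ^+ 2)) *: N + ((1 - v ^+ 2) / (1 + v ^+ 2)) *: T].
Proof.
rewrite /dot.
case: N T N' T' => [n1 n2] [t1 t2] [p1 p2] [q1 q2] /=.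
move=> rho0 v0 v'0 nn tt nt pp qq pq [e1 e2] np.
rewrite /GRing.scale/= in e1 e2.
have vv : v' = v.
  have : rho * (v' ^+ 2 - v ^+ 2) = 0.
    have : (n1 + v * t1) ^+ 2 + (n2 + v * t2) ^+ 2 =
           (p1 - v' * q1) ^+ 2 + (p2 - v' * q2) ^+ 2 by rewrite e1 e2.
    have -> : (n1 + v * t1) ^+ 2 + (n2 + v * t2) ^+ 2 = rho + v ^+ 2 * rho.
      have h1 := congr1 ( *%R v) nt; have h2 := congr1 ( *%R (v ^+ 2)) tt; lra.
    have -> : (p1 - v' * q1) ^+ 2 + (p2 - v' * q2) ^+ 2 = rho + v' ^+ 2 * rho.
      have h1 := congr1 ( *%R v') pq; have h2 := congr1 ( *%R (v' ^+ 2)) qq; lra.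
    lra.
  move/eqP; rewrite mulf_eq0 gt_eqF//= subr_eq0 eqrXn2// => /eqP.
  by [].
subst v'.
(* With equal handedness the second frame is the first one turned; with opposite handedness the
   equation forces [N = N']. *)
have [h|h] := orthogonal_rotation nn tt nt; have [h'|h'] := orthogonal_rotation pp qq pq; case: h => ? ?;
  case: h' => ? ?; subst t1 t2 q1 q2.
- have [f1 f2] := @turn v n1 n2 p1 p2 ltac:(lra) ltac:(lra).
  have v1 : 0 < v.
    rewrite lt_def v0 andbT; apply/eqP => v00; apply: np; rewrite f1 f2 v00.
    by congr pair; field.
  split => //; rewrite f1 f2; apply: pair_ext; rewrite /= /GRing.scale/=; field;
    by rewrite gt_eqF// ltr_wpDr ?sqr_ge0.
- exfalso; apply: np; have [-> ->] := @same v n1 n2 p1 p2 ltac:(lra) ltac:(lra).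
  by [].
- exfalso; apply: np; have [-> ->] := @same (- v) n1 n2 p1 p2 ltac:(lra) ltac:(lra).
  by [].
- have [f1 f2] := @turn (- v) n1 n2 p1 p2 ltac:(lra) ltac:(lra).
  have v1 : 0 < v.
    rewrite lt_def v0 andbT; apply/eqP => v00; apply: np; rewrite f1 f2 v00 oppr0.
    by congr pair; field.
  split => //; rewrite f1 f2 !sqrrN; apply: pair_ext; rewrite /= /GRing.scale/=; field;
    by rewrite gt_eqF// ltr_wpDr ?sqr_ge0.
Qed.

(** All three points lie on the line tangent to the circle at [I + N]. This excludes that two sides
    share a contact point. *)
Let polar_collinear N I A B C (rho : R) : 0 < rho -> dot N N = rho ->
  dot N (A - I) = rho -> dot N (B - I) = rho -> dot N (C - I) = rho ->
  collinear A B C.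
Proof.
rewrite /dot/= => rho0 nn hA hB hC.
exists N.1, N.2, (rho + N.1 * I.1 + N.2 * I.2); split.
  by move=> [n1 n2]; move: nn; rewrite n1 n2 !mul0r addr0 => r0; rewrite -r0 ltxx in rho0.
by move=> P; rewrite !inE => /or3P[] /eqP ->; lra.
Qed.

(* [N] and [T] span an orthogonal frame at the incenter adapted to the side
   [A B]; in the unit of the inradius the tangent lengths at [A], [B], [C] are
   [u], [v], [w]. *)
Record contact_frame A B C I N T (rho u v w : R) : Prop := ContactFrame {
  frame_gt0 : 0 < rho;
  frameNN : dot N N = rho;
  frameTT : dot T T = rho;
  frameNT : dot N T = 0;
  tangent_gt0 : [/\ 0 < u, 0 < v & 0 < w];
  tangent_sum : u + v + w = u * v * w;
  frameA : A = I + N - u *: T;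
  frameB : B = I + N + v *: T;
  frameC : C = I + ((1 - v ^+ 2 - 2 * v * w) / (1 + v ^+ 2)) *: N +
               ((2 * v + w * (1 - v ^+ 2)) / (1 + v ^+ 2)) *: T
}.

Lemma contact_frame_exists A B C I : nondegenerate_triangle A B C ->
  is_incenter A B C I -> exists N T rho u v w, contact_frame A B C I N T rho u v w.
Proof.
move=> ndA [r [r0 disk tAB tBC tCA]].
have ndB : ~ collinear B C A.
  move=> [a [b [c [ab h]]]]; apply: ndA; exists a, b, c; split => // X hX.
  by apply: h; move: hX; rewrite !inE => /or3P[] ->; rewrite ?orbT.
have ndC : ~ collinear C A B.
  move=> [a [b [c [ab h]]]]; apply: ndA; exists a, b, c; split => // X hX.
  by apply: h; move: hX; rewrite !inE => /or3P[] ->; rewrite ?orbT.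
have diskB : edisk I r `<=` triangle B C A.
  move=> X /disk[a [b [c [a0 b0 c0 abc ->]]]]; exists b, c, a; split => //; first lra.
  by rewrite -addrA addrC.
have diskC : edisk I r `<=` triangle C A B.
  move=> X /disk[a [b [c [a0 b0 c0 abc ->]]]]; exists c, a, b; split => //; first lra.
  by rewrite addrC addrA.
have [N [T [u [v [[NN TT NT] [u0 v0 eA eB]]]]]] := contact_side r0 disk ndA tAB.
have [N1 [T1 [v1 [w [[NN1 TT1 NT1] [v10 w0 eB1 eC1]]]]]] := contact_side r0 diskB ndB tBC.
have [N2 [T2 [w2 [u2 [[NN2 TT2 NT2] [w20 u20 eC2 eA2]]]]]] := contact_side r0 diskC ndC tCA.
have rho0 : 0 < r ^+ 2 by rewrite exprn_gt0.
have dotA : dot N (A - I) = r ^+ 2.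
  by rewrite eA; move: NN NT; rewrite /dot/= /GRing.scale/= => NN NT;
  have := congr1 ( *%R u) NT; lra.
have dotB : dot N (B - I) = r ^+ 2.
  by rewrite eB; move: NN NT; rewrite /dot/= /GRing.scale/= => NN NT;
  have := congr1 ( *%R v) NT; lra.
have N1N : N <> N1.
  move=> e; apply: ndA; apply: (@polar_collinear N I _ _ _ _ rho0 NN) => //.
  by rewrite e eC1; move: NN1 NT1; rewrite /dot/= /GRing.scale/= => NN1 NT1;
  have := congr1 ( *%R w) NT1; lra.
have N2N : N <> N2.
  move=> e; apply: ndA; apply: (@polar_collinear N I _ _ _ _ rho0 NN) => //.
  by rewrite e eC2; move: NN2 NT2; rewrite /dot/= /GRing.scale/= => NN2 NT2;
  have := congr1 ( *%R w2) NT2; lra.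
have [] := @contact_turn N T N1 T1 (r ^+ 2) v v1 => //.
  by apply: (addrI I); rewrite !addrA -eB -eB1.
move=> ev v_gt0 N1E T1E; subst v1.
(* At [A] the sides are met in the reverse direction, hence the opposite tangent vectors. *)
have [] := @contact_turn N (- T) N2 (- T2) (r ^+ 2) u u2 => //.
- by rewrite -TT /dot/=; ring.
- by rewrite -oppr0 -NT /dot/=; ring.
- by rewrite -TT2 /dot/=; ring.
- by rewrite -oppr0 -NT2 /dot/=; ring.
- by apply: (addrI I); rewrite !scalerN opprK !addrA -eA -eA2.
move=> eu u_gt0 N2E T2E; subst u2.
(* Both tangent lengths at [C] are read off from the distance of [C] to [I]. *)
have ww : w2 = w.
  have eCC : N1 + w *: T1 = N2 - w2 *: T2.
    by apply: (addrI I); rewrite !addrA -eC1 -eC2.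
  have : dot (N1 + w *: T1) (N1 + w *: T1) = dot (N2 - w2 *: T2) (N2 - w2 *: T2).
    by rewrite eCC.
  have -> : dot (N1 + w *: T1) (N1 + w *: T1) = r ^+ 2 + w ^+ 2 * r ^+ 2.
    rewrite -{1}NN1 -TT1 -[RHS]addr0 -[in RHS](mulr0 (2 * w)) -[in RHS]NT1.
    by rewrite /dot/= /GRing.scale/=; ring.
  have -> : dot (N2 - w2 *: T2) (N2 - w2 *: T2) = r ^+ 2 + w2 ^+ 2 * r ^+ 2.
    rewrite -{1}NN2 -TT2 -[RHS]addr0 -[in RHS](mulr0 (- (2 * w2))) -[in RHS]NT2.
    by rewrite /dot/= /GRing.scale/=; ring.
  move/addrI/(mulIf (lt0r_neq0 rho0))/eqP; rewrite eqrXn2// => /eqP.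
  by [].
subst w2.
have u1 : 1 + u ^+ 2 != 0 by rewrite gt_eqF// ltr_wpDr ?sqr_ge0.
have v1 : 1 + v ^+ 2 != 0 by rewrite gt_eqF// ltr_wpDr ?sqr_ge0.
(* The components along [T] of the two expressions of [C] agree; after cross-multiplication the
   difference is a multiple of [(1 + u v) (u + v + w - u v w)]. *)
have uvw : u + v + w = u * v * w.
  have eCC : dot T (N1 + w *: T1) = dot T (N2 - w *: T2).
    by congr (dot T _); apply: (addrI I); rewrite !addrA -eC1 -eC2.
  move: eCC; rewrite -[T2]opprK T2E N2E N1E T1E.
  have TN : dot T N = 0 by rewrite -NT /dot; ring.
  have -> : dot T ((1 - v ^+ 2) / (1 + v ^+ 2) *: N + (2 * v / (1 + v ^+ 2)) *: T +
      w *: (- (2 * v) / (1 + v ^+ 2) *: N + ((1 - v ^+ 2) / (1 + v ^+ 2)) *: T)) =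
      (2 * v + w * (1 - v ^+ 2)) / (1 + v ^+ 2) * dot T T +
      (1 - v ^+ 2 - 2 * v * w) / (1 + v ^+ 2) * dot T N.
    by rewrite /dot/= /GRing.scale/=; field.
  have -> : dot T ((1 - u ^+ 2) / (1 + u ^+ 2) *: N + (2 * u / (1 + u ^+ 2)) *: - T -
      w *: - (- (2 * u) / (1 + u ^+ 2) *: N + ((1 - u ^+ 2) / (1 + u ^+ 2)) *: - T)) =
      (- (2 * u) - w * (1 - u ^+ 2)) / (1 + u ^+ 2) * dot T T +
      (1 - u ^+ 2 - 2 * u * w) / (1 + u ^+ 2) * dot T N.
    by rewrite /dot/= /GRing.scale/=; field.
  rewrite TT TN !mulr0 !addr0 => /(mulIf (lt0r_neq0 rho0)) /eqP.
  rewrite eqr_div// => /eqP e.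
  have uv1 : 1 + u * v != 0 by rewrite gt_eqF// ltr_wpDr ?mulr_ge0.
  apply: (mulIf uv1); lra.
have w_gt0 : 0 < w.
  rewrite lt_def w0 andbT; apply/eqP => w00; move: uvw; rewrite w00 mulr0; lra.
exists N, T, (r ^+ 2), u, v, w; split => //.
rewrite eC1 N1E T1E; apply: pair_ext; rewrite /= /GRing.scale/=; field; exact: v1.
Qed.

End Contact.

(** * Frames at the incenter *)

Section Frames.
Context {R : realType}.
Local Notation mu := (@lebesgue_measure R).
Variables (I N T : R * R) (rho : R).
Hypotheses (rho0 : 0 < rho) (NN : dot N N = rho) (TT : dot T T = rho)
  (NT : dot N T = 0).
Implicit Types (f z : R * R) (k : R).

(* A frame is given by the cosine and the sine of its angle with [N], [T]. *)
Definition coord1 f z : R := (f.1 * dot N (z - I) + f.2 * dot T (z - I)) / rho.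
Definition coord2 f z : R := (- f.2 * dot N (z - I) + f.1 * dot T (z - I)) / rho.
Definition slope f z : R := coord2 f z / coord1 f z.
(** The slope range is half-open so that the three cones over the sides are disjoint and miss only
    the incenter. *)
Definition cone f (a b : R) : set (R * R) :=
  [set z | 0 < coord1 f z /\ - a <= slope f z < b].

Definition unit_vector f := f.1 ^+ 2 + f.2 ^+ 2 = 1.

Let rhoN : rho != 0. Proof. by rewrite gt_eqF. Qed.

Lemma NT_perp : (T.1 = - N.2 /\ T.2 = N.1) \/ (T.1 = N.2 /\ T.2 = - N.1).
Proof. exact: orthogonal_rotation NN TT NT. Qed.

Let NE : rho = N.1 ^+ 2 + N.2 ^+ 2. Proof. by rewrite -NN /dot; ring. Qed.

Lemma frame_expand z :
  z = I + coord1 (1, 0) z *: N + coord2 (1, 0) z *: T.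
Proof.
have := rhoN; rewrite /coord1 /coord2 /dot/= oppr0 !mul0r !mul1r addr0 add0r NE.
by case: NT_perp => -[t1 t2] r0; apply: pair_ext; rewrite /= /GRing.scale/= t1 t2; field.
Qed.

Lemma dot_frame f z z' : unit_vector f ->
  dot (z - I) (z' - I) = rho * (coord1 f z * coord1 f z' + coord2 f z * coord2 f z').
Proof.
rewrite /unit_vector => f1.
have -> : rho * (coord1 f z * coord1 f z' + coord2 f z * coord2 f z') =
  (f.1 ^+ 2 + f.2 ^+ 2) *
  (dot N (z - I) * dot N (z' - I) + dot T (z - I) * dot T (z' - I)) / rho.
  by rewrite /coord1 /coord2; field.
have := rhoN; rewrite f1 mul1r /dot NE.
by case: NT_perp => -[-> ->] r0; field.
Qed.

Let off f := - ((f.1 * dot N I + f.2 * dot T I) / rho).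

Lemma coord1_affine f z : coord1 f z =
  (f.1 * N.1 + f.2 * T.1) / rho * z.1 + (f.1 * N.2 + f.2 * T.2) / rho * z.2 + off f.
Proof. by rewrite /coord1 /off /dot/=; field. Qed.

Lemma coord2_affine f z : coord2 f z =
  (- f.2 * N.1 + f.1 * T.1) / rho * z.1 + (- f.2 * N.2 + f.1 * T.2) / rho * z.2 +
  off (- f.2, f.1).
Proof. by rewrite /coord2 /off /dot/=; field. Qed.

Lemma measurable_coord1 f : measurable_fun setT (coord1 f).
Proof. by rewrite (funext (coord1_affine f)); exact: measurable_affine. Qed.

Lemma measurable_coord2 f : measurable_fun setT (coord2 f).
Proof. by rewrite (funext (coord2_affine f)); exact: measurable_affine. Qed.

Lemma measurable_slope f : measurable_fun setT (slope f).
Proof.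
apply: measurable_funM; first exact: measurable_coord2.
exact: measurableT_comp measurable_inv (measurable_coord1 f).
Qed.

(** The coordinates [coord1], [coord2] have Jacobian determinant [1 / rho] or [- 1 / rho], according
    to the handedness of [N], [T]. *)
Lemma area_sector f (J : set R) : unit_vector f -> measurable J ->
  area [set z | 0 < coord1 f z < 1 /\ J (slope f z)] = ((rho / 2)%:E * mu J)%E.
Proof.
rewrite /unit_vector => f1 mJ.
set a := (f.1 * N.1 + f.2 * T.1) / rho; set b := (f.1 * N.2 + f.2 * T.2) / rho.
set c := (- f.2 * N.1 + f.1 * T.1) / rho; set e := (- f.2 * N.2 + f.1 * T.2) / rho.
have det : `|a * e - b * c|^-1 = rho.
  have -> : a * e - b * c = (f.1 ^+ 2 + f.2 ^+ 2) * (N.1 * T.2 - N.2 * T.1) / rho ^+ 2.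
    by rewrite /a /b /c /e; field.
  rewrite f1 mul1r; have [->|->] : N.1 * T.2 - N.2 * T.1 = rho \/ N.1 * T.2 - N.2 * T.1 = - rho.
  - by case: NT_perp => -[-> ->]; [left|right]; rewrite NE; ring.
  - rewrite ger0_norm; last by rewrite divr_ge0 ?sqr_ge0// ltW.
    by field.
  - rewrite mulNr normrN ger0_norm; last by rewrite divr_ge0 ?sqr_ge0// ltW.
    by field.
have detN : a * e - b * c != 0.
  by apply: contra_eq_neq det => ->; rewrite normr0 invr0 eq_sym.
rewrite -det -(area_cone (off f) (off (- f.2, f.1)) detN mJ).
by congr area; apply/funext => z; rewrite /mkset /slope coord1_affine coord2_affine.
Qed.

(** Cosine and sine of [2 arctan k]: with [k] the tangent length at a vertex, this is the exterior
    angle there, which carries the frame of one side to that of the next. *)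
Definition turn_cos k := (1 - k ^+ 2) / (1 + k ^+ 2).
Definition turn_sin k := 2 * k / (1 + k ^+ 2).
Definition turn k f : R * R :=
  (turn_cos k * f.1 - turn_sin k * f.2, turn_sin k * f.1 + turn_cos k * f.2).

Let kk k : 1 + k ^+ 2 != 0. Proof. by rewrite gt_eqF// ltr_wpDr ?sqr_ge0. Qed.
Let kk0 k : 0 < 1 + k ^+ 2. Proof. by rewrite ltr_wpDr ?sqr_ge0. Qed.

Lemma unit_turn k f : unit_vector f -> unit_vector (turn k f).
Proof.
rewrite /unit_vector /turn /= => <-.
by rewrite /turn_cos /turn_sin; field.
Qed.

Lemma coord1_turn k f z :
  coord1 (turn k f) z = turn_cos k * coord1 f z + turn_sin k * coord2 f z.
Proof. by rewrite /coord1 /coord2 /turn/=; field. Qed.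

Lemma coord2_turn k f z :
  coord2 (turn k f) z = - turn_sin k * coord1 f z + turn_cos k * coord2 f z.
Proof. by rewrite /coord1 /coord2 /turn/=; field. Qed.

Lemma coord1_unturn k f z :
  coord1 f z = turn_cos k * coord1 (turn k f) z - turn_sin k * coord2 (turn k f) z.
Proof.
by rewrite coord1_turn coord2_turn /turn_cos /turn_sin; field.
Qed.

Lemma coord2_unturn k f z :
  coord2 f z = turn_sin k * coord1 (turn k f) z + turn_cos k * coord2 (turn k f) z.
Proof.
by rewrite coord1_turn coord2_turn /turn_cos /turn_sin; field.
Qed.

(* A point of the cone over one side is closer to the incenter than the lines
   through the two other sides as soon as it is closer than that side. *)
Lemma coord1_turn_lt k f z : 0 < k -> 0 < coord1 f z < 1 -> slope f z < k ->
  coord1 (turn k f) z < 1.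
Proof.
move=> k0 /andP[c0 c1]; rewrite /slope ltr_pdivrMr// => c2.
rewrite coord1_turn; apply: le_lt_trans c1.
rewrite -(ler_pM2l (kk0 k)).
have -> : (1 + k ^+ 2) * (turn_cos k * coord1 f z + turn_sin k * coord2 f z) =
  (1 - k ^+ 2) * coord1 f z + 2 * k * coord2 f z.
  by rewrite /turn_cos /turn_sin; field.
by have := ltr_pM2l k0 (coord2 f z) (k * coord1 f z); rewrite c2 => h; lra.
Qed.

Lemma coord1_unturn_lt k f z : 0 < k -> 0 < coord1 (turn k f) z < 1 ->
  - k <= slope (turn k f) z -> coord1 f z < 1.
Proof.
move=> k0 /andP[c0 c1]; rewrite /slope ler_pdivlMr// => c2.
rewrite (coord1_unturn k); apply: le_lt_trans c1.
set x := coord1 _ _ in c0 c2 *; set y := coord2 _ _ in c2 *.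
rewrite -(ler_pM2l (kk0 k)).
have -> : (1 + k ^+ 2) * (turn_cos k * x - turn_sin k * y) =
  (1 - k ^+ 2) * x - 2 * k * y.
  by rewrite /turn_cos /turn_sin; field.
by have := ler_pM2l k0 (- k * x) y; rewrite c2 => h; lra.
Qed.

Lemma obtuse_same f z z' : unit_vector f -> 0 < coord1 f z -> 0 < coord1 f z' ->
  (dot (z - I) (z' - I) <= 0) = (1 + slope f z * slope f z' <= 0).
Proof.
move=> f1 c0 c0'; rewrite (dot_frame z z' f1) pmulr_rle0// /slope.
have -> : coord1 f z * coord1 f z' + coord2 f z * coord2 f z' =
  coord1 f z * coord1 f z' *
  (1 + coord2 f z / coord1 f z * (coord2 f z' / coord1 f z')).
  by field; rewrite !gt_eqF.
exact: pmulr_rle0 (mulr_gt0 c0 c0').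
Qed.

Lemma obtuse_adjacent k f z z' : unit_vector f ->
  0 < coord1 f z -> 0 < coord1 (turn k f) z' ->
  (dot (z - I) (z' - I) <= 0) =
  ((1 - k ^+ 2) * (1 + slope f z * slope (turn k f) z') +
    2 * k * (slope f z - slope (turn k f) z') <= 0).
Proof.
move=> f1 c0 c0'; rewrite (dot_frame z z' f1) pmulr_rle0// /slope.
rewrite (coord1_unturn k f z') (coord2_unturn k f z').
set x := coord1 f z in c0 *; set y := coord2 f z.
set x' := coord1 _ _ in c0' *; set y' := coord2 _ _.
have -> : x * (turn_cos k * x' - turn_sin k * y') + y * (turn_sin k * x' + turn_cos k * y')
  = x * x' / (1 + k ^+ 2) *
  ((1 - k ^+ 2) * (1 + y / x * (y' / x')) + 2 * k * (y / x - y' / x')).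
  by rewrite /turn_cos /turn_sin; field; rewrite kk !gt_eqF.
exact: pmulr_rle0 (divr_gt0 (mulr_gt0 c0 c0') (kk0 k)).
Qed.

End Frames.

(** * The interior of the triangle *)

Section TriangleInterior.
Context {R : realType}.
Local Notation mu := (@lebesgue_measure R).
Variables (A B C I N T : R * R) (rho u v w : R).
Hypothesis H : contact_frame A B C I N T rho u v w.
Local Notation c1 := (coord1 I N T rho).
Local Notation c2 := (coord2 I N T rho).
Implicit Types f z : R * R.

Definition frameAB : R * R := (1, 0).
Definition frameBC (v : R) := turn v frameAB.
Definition frameCA (u : R) : R * R := (turn_cos u, - turn_sin u).

Lemma unit_frameAB : unit_vector frameAB.
Proof. by rewrite /unit_vector /= expr1n expr0n addr0. Qed.

Let kk k : 1 + k ^+ 2 != 0 :> R. Proof. by rewrite gt_eqF// ltr_wpDr ?sqr_ge0. Qed.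

Let u0 : 0 < u. Proof. by case: (tangent_gt0 H). Qed.
Let v0 : 0 < v. Proof. by case: (tangent_gt0 H). Qed.
Let w0 : 0 < w. Proof. by case: (tangent_gt0 H). Qed.
Let rhoN : rho != 0. Proof. by rewrite gt_eqF// (frame_gt0 H). Qed.

Lemma tangent_uv_gt1 : 0 < u * v - 1.
Proof. by rewrite -(pmulr_lgt0 _ w0); have := tangent_sum H; have := u0; have := v0; lra. Qed.

Let uvN : u * v - 1 != 0. Proof. by rewrite gt_eqF// tangent_uv_gt1. Qed.

Lemma tangent_wE : w = (u + v) / (u * v - 1).
Proof. by apply: (mulIf uvN); rewrite divfK//; have := tangent_sum H; lra. Qed.

Let w2E : 1 + w ^+ 2 = (1 + u ^+ 2) * (1 + v ^+ 2) / (u * v - 1) ^+ 2.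
Proof. by rewrite tangent_wE; field. Qed.

Let cosw : turn_cos w = ((u * v - 1) ^+ 2 - (u + v) ^+ 2) / ((1 + u ^+ 2) * (1 + v ^+ 2)).
Proof.
rewrite /turn_cos w2E {1}tangent_wE; field.
by rewrite !kk uvN.
Qed.

Let sinw : turn_sin w = 2 * (u * v - 1) * (u + v) / ((1 + u ^+ 2) * (1 + v ^+ 2)).
Proof.
rewrite /turn_sin w2E {1}tangent_wE; field.
by rewrite !kk uvN.
Qed.

(** The three turns close up because [u + v + w = u v w] makes the exterior angles add up to a full
    turn; it enters through the formula for [w]. *)
Lemma turn_frameBC : turn w (frameBC v) = frameCA u.
Proof.
by apply: pair_ext; rewrite /turn/= cosw sinw /turn_cos /turn_sin; field; rewrite !kk.
Qed.

Lemma turn_frameCA : turn u (frameCA u) = frameAB.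
Proof.
by apply: pair_ext; rewrite /turn/= /turn_cos /turn_sin; field.
Qed.

Lemma unit_frameBC : unit_vector (frameBC v).
Proof. exact/unit_turn/unit_frameAB. Qed.

Lemma unit_frameCA : unit_vector (frameCA u).
Proof. by rewrite -turn_frameBC; exact/unit_turn/unit_frameBC. Qed.

Lemma coord1_point f (x y : R) : c1 f (I + x *: N + y *: T) = f.1 * x + f.2 * y.
Proof.
have -> : c1 f (I + x *: N + y *: T) =
  (f.1 * (x * dot N N + y * dot N T) + f.2 * (x * dot N T + y * dot T T)) / rho.
  by rewrite /coord1 /dot/= /GRing.scale/=; field.
by rewrite (frameNN H) (frameTT H) (frameNT H); field.
Qed.

Let c1A f : c1 f A = f.1 - f.2 * u.
Proof.
rewrite (_ : A = I + 1 *: N + (- u) *: T); first by rewrite coord1_point; ring.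
by rewrite (frameA H) scaleNr scale1r.
Qed.

Let c1B f : c1 f B = f.1 + f.2 * v.
Proof.
rewrite (_ : B = I + 1 *: N + v *: T); first by rewrite coord1_point; ring.
by rewrite (frameB H) scale1r.
Qed.

Let c1C f : c1 f C = (f.1 * (1 - v ^+ 2 - 2 * v * w) +
  f.2 * (2 * v + w * (1 - v ^+ 2))) / (1 + v ^+ 2).
Proof. by rewrite [in LHS](frameC H) coord1_point; field. Qed.

Let c1_convex f (a b c : R) X Y Z : a + b + c = 1 ->
  c1 f (a *: X + b *: Y + c *: Z) = a * c1 f X + b * c1 f Y + c * c1 f Z.
Proof.
move=> abc; have -> : a = 1 - b - c by lra.
by rewrite /coord1 /dot/= /GRing.scale/=; field.
Qed.

Let le_frac (x k : R) : x <= 1 + k ^+ 2 -> x / (1 + k ^+ 2) <= 1.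
Proof. by move=> h; rewrite ler_pdivrMr ?mul1r// ltr_wpDr ?sqr_ge0. Qed.

Lemma triangle_coord1_le z : triangle A B C z ->
  [/\ c1 frameAB z <= 1, c1 (frameBC v) z <= 1 & c1 (frameCA u) z <= 1].
Proof.
have hu := u0; have hv := v0; have hw := w0.
have uv := mulr_gt0 hu hv; have vw := mulr_gt0 hv hw; have wu := mulr_gt0 hw hu.
move=> [a [b [c [a0 b0 c0 abc ->]]]].
have key f : c1 f A <= 1 -> c1 f B <= 1 -> c1 f C <= 1 ->
    c1 f (a *: A + b *: B + c *: C) <= 1.
  move=> hA hB hC; rewrite c1_convex// -abc.
  by rewrite lerD// ?lerD// ler_piMr.
have le1 (x y : R) : x = y -> y <= 1 -> x <= 1 by move=> ->.
split; apply: key; rewrite ?c1A ?c1B ?c1C /frameAB /frameBC /frameCA /turn/=.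
- by rewrite mul0r subr0.
- by rewrite mul0r addr0.
- by rewrite mul0r addr0 mul1r le_frac//; have := sqr_ge0 v; lra.
- apply: (@le1 _ ((1 - v ^+ 2 - 2 * v * u) / (1 + v ^+ 2))).
    by rewrite /turn_cos /turn_sin; field.
  by apply: le_frac; have := sqr_ge0 v; lra.
- by apply: (@le1 _ 1) => //; rewrite /turn_cos /turn_sin; field.
- by apply: (@le1 _ 1) => //; rewrite /turn_cos /turn_sin; field.
- by apply: (@le1 _ 1) => //; rewrite /turn_cos /turn_sin; field.
- apply: (@le1 _ ((1 - u ^+ 2 - 2 * u * v) / (1 + u ^+ 2))).
    by rewrite /turn_cos /turn_sin; field.
  by apply: le_frac; have := sqr_ge0 u; lra.
- apply: (@le1 _ 1) => //; rewrite tangent_wE /turn_cos /turn_sin; field.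
  by rewrite !kk uvN.
Qed.

Lemma coord1_lt_triangle z :
  c1 frameAB z < 1 -> c1 (frameBC v) z < 1 -> c1 (frameCA u) z < 1 -> triangle A B C z.
Proof.
have hu := u0; have hv := v0; have huv := tangent_uv_gt1.
have sq (x : R) : 0 <= 1 + x ^+ 2 by rewrite addr_ge0 ?sqr_ge0.
have d1 : 0 < 2 * v * (u + v) by rewrite !mulr_gt0 ?addr_gt0.
have d2 : 0 < 2 * u * (u + v) by rewrite !mulr_gt0 ?addr_gt0.
have d3 : 0 < 2 * u * v by rewrite !mulr_gt0.
have uN : u != 0 by rewrite gt_eqF.
have vN : v != 0 by rewrite gt_eqF.
have uvS : u + v != 0 by rewrite gt_eqF// addr_gt0.
have zE := @frame_expand R I N T rho (frame_gt0 H) (frameNN H) (frameTT H) (frameNT H) z.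
set p := c1 (1, 0) z in zE; set q := c2 (1, 0) z in zE.
have cE f : c1 f z = f.1 * p + f.2 * q by rewrite zE coord1_point.
rewrite !cE /= mul1r mul0r addr0 /turn/= !mulr1 !mulr0 subr0 addr0 => hp ha hb.
(* Barycentric coordinates: the distance to the opposite side over the height, in the unit of the
   inradius. For [A] the height is [2 v (u + v) / (1 + v^2)]. *)
exists ((1 - (turn_cos v * p + turn_sin v * q)) * (1 + v ^+ 2) / (2 * v * (u + v))).
exists ((1 - (turn_cos u * p + - turn_sin u * q)) * (1 + u ^+ 2) / (2 * u * (u + v))).
exists ((1 - p) * (u * v - 1) / (2 * u * v)).
split.
- by apply: divr_ge0; [apply: mulr_ge0; [lra|exact: sq]|exact: ltW].
- by apply: divr_ge0; [apply: mulr_ge0; [lra|exact: sq]|exact: ltW].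
- by apply: divr_ge0; [apply: mulr_ge0; lra|exact: ltW].
- by rewrite /turn_cos /turn_sin; field; rewrite uvS uN vN !kk.
rewrite zE (frameA H) (frameB H) (frameC H) tangent_wE /turn_cos /turn_sin.
by apply: pair_ext; rewrite /= /GRing.scale/=; field; rewrite uvS uN vN !kk uvN.
Qed.

Let c1_shift f (t : R) z : unit_vector f ->
  c1 f (z + t *: (f.1 *: N + f.2 *: T)) = c1 f z + t.
Proof.
rewrite /unit_vector => f1.
have -> : c1 f (z + t *: (f.1 *: N + f.2 *: T)) = c1 f z + t *
  (f.1 ^+ 2 * dot N N + 2 * f.1 * f.2 * dot N T + f.2 ^+ 2 * dot T T) / rho.
  by rewrite /coord1 /dot/= /GRing.scale/=; field.
rewrite (frameNN H) (frameTT H) (frameNT H).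
rewrite (_ : _ + _ + f.2 ^+ 2 * rho = (f.1 ^+ 2 + f.2 ^+ 2) * rho); last by ring.
by rewrite f1 mul1r mulfK.
Qed.

(** A step [t] along the normal of the side raises the coordinate by [t]; from an interior point a
    small step stays in [S], where the coordinate is at most 1. *)
Let interior_coord1_lt (S : set (R * R)) f z : unit_vector f ->
  (forall z', S z' -> c1 f z' <= 1) -> S° z -> c1 f z < 1.
Proof.
move=> f1 Sle; rewrite /interior/= => /nbhs_ballP[e /= e0 zS].
pose d := f.1 *: N + f.2 *: T.
have D0 : 0 < 1 + `|d.1| + `|d.2| by rewrite addrC ltr_wpDl// ltr_wpDr.
pose t := e / 2 / (1 + `|d.1| + `|d.2|).
have t0 : 0 < t by rewrite !divr_gt0.
have te (x : R) : `|x| <= `|d.1| + `|d.2| -> `|t * x| < e.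
  move=> hx; rewrite normrM (gtr0_norm t0) /t mulrAC ltr_pdivrMr//.
  have := normr_ge0 x; have := normr_ge0 d.1; have := normr_ge0 d.2 => ? ? ?.
  by rewrite mulrAC ltr_pdivrMr//; nra.
have /Sle : S (z + t *: d).
  apply: zS; split; rewrite /ball/= /ball_/= opprD addNKr normrN.
    by apply: te; rewrite lerDl.
  by apply: te; rewrite lerDr.
by rewrite c1_shift//; lra.
Qed.

Let open_coord1_lt f : open [set z | c1 f z < 1].
Proof.
rewrite (_ : [set z | _] = c1 f @^-1` [set x | x < 1])//.
apply: open_comp; last exact: open_lt.
move=> z _; rewrite (funext (coord1_affine I N T (frame_gt0 H) f)).
apply: cvgD; last exact: cvg_cst.
by apply: cvgD; apply: cvgM; (exact: cvg_cst || exact: cvg_fst || exact: cvg_snd).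
Qed.

Lemma triangle_interiorP z : (triangle A B C)° z <->
  [/\ c1 frameAB z < 1, c1 (frameBC v) z < 1 & c1 (frameCA u) z < 1].
Proof.
split.
  move=> Tz; split.
  - by apply: (interior_coord1_lt unit_frameAB _ Tz) => z' /triangle_coord1_le[].
  - by apply: (interior_coord1_lt unit_frameBC _ Tz) => z' /triangle_coord1_le[].
  - by apply: (interior_coord1_lt unit_frameCA _ Tz) => z' /triangle_coord1_le[].
move=> [h1 h2 h3].
pose O := [set z | c1 frameAB z < 1] `&` [set z | c1 (frameBC v) z < 1] `&`
  [set z | c1 (frameCA u) z < 1].
have oO : open O.
  by apply: openI; [apply: openI|]; exact: open_coord1_lt.
have OT : O `<=` triangle A B C.
  by move=> z' [[? ?] ?]; exact: coord1_lt_triangle.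
by move: OT; rewrite open_subsetE// => /(_ z); apply.
Qed.

End TriangleInterior.

(** * The probability of an obtuse angle *)

Lemma probability_split3 (R : realType) d (X : measurableType d)
    (m : {measure set X -> \bar R}) (E A1 A2 A3 Z : set X) :
  measurable E -> measurable A1 -> measurable A2 -> measurable A3 -> measurable Z ->
  A1 `&` A2 = set0 -> A2 `&` A3 = set0 -> A3 `&` A1 = set0 -> m Z = 0%E ->
  (forall x, [\/ A1 x, A2 x, A3 x | Z x]) ->
  m E = (m (E `&` A1) + m (E `&` A2) + m (E `&` A3))%E.
Proof.
move=> mE m1 m2 m3 mZ d12 d23 d31 Z0 cov.
have ne (S S' : set X) x : S `&` S' = set0 -> S x -> S' x -> False.
  by move=> e sx s'x; have : set0 x by rewrite -e.
have mE1 : measurable (E `&` ~` A1) by apply: measurableI => //; exact: measurableC.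
have mE2 : measurable (E `&` ~` A1 `&` ~` A2) by apply: measurableI => //; exact: measurableC.
rewrite (measure_split m mE m1) (measure_split m mE1 m2) (measure_split m mE2 m3) !addeA.
rewrite (_ : E `&` ~` A1 `&` A2 = E `&` A2); last first.
  apply/seteqP; split => x /= [].
    by move=> [].
  by move=> ? x2; split => //; split => // x1; exact: ne d12 x1 x2.
rewrite (_ : E `&` ~` A1 `&` ~` A2 `&` A3 = E `&` A3); last first.
  apply/seteqP; split => x /= [].
    by move=> [[]].
  move=> ? x3; split => //; split; first by split => // x1; exact: ne d31 x3 x1.
  by move=> x2; exact: ne d23 x2 x3.
have -> : m (E `&` ~` A1 `&` ~` A2 `&` ~` A3) = 0%E; last by rewrite adde0.
apply: (@subset_measure0 _ _ _ m _ Z) => //.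
  by apply: measurableI => //; exact: measurableC.
by move=> x [[[_ /= n1] n2] n3]; have [//|//|//|//] := cov x.
Qed.

Section InscribedProbability.
Context {R : realType}.
Local Notation mu := (@lebesgue_measure R).
Variables (A B C I N T : R * R) (rho u v w : R).
Hypothesis H : contact_frame A B C I N T rho u v w.
Local Notation c1 := (coord1 I N T rho).
Local Notation c2 := (coord2 I N T rho).
Local Notation slope := (slope I N T rho).
Local Notation cone := (cone I N T rho).
Implicit Types f z : R * R.

Let rho0 : 0 < rho. Proof. exact: frame_gt0 H. Qed.
Let u0 : 0 < u. Proof. by case: (tangent_gt0 H). Qed.
Let v0 : 0 < v. Proof. by case: (tangent_gt0 H). Qed.
Let w0 : 0 < w. Proof. by case: (tangent_gt0 H). Qed.

Lemma measurable_cone f a b : measurable (cone f a b).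
Proof.
rewrite (_ : cone f a b = [set z | 0 < c1 f z] `&` [set z | - a <= slope f z] `&`
  [set z | slope f z < b]); last first.
  by apply/seteqP; split => z /=; [case=> -> /andP[-> ->]|case=> -[? ?] ?; split => //; apply/andP].
apply: measurableI; first apply: measurableI.
- by apply: measurable_lt_set => //; exact: measurable_coord1.
- by apply: measurable_le_set => //; exact: measurable_slope.
- by apply: measurable_lt_set => //; exact: measurable_slope.
Qed.

(** Within a cone the inequality for its own side implies the other two. Three consecutive frames
    appear so that one statement covers every side. *)
Lemma cone_interior g (k k' : R) (J : set R) : 0 < k -> 0 < k' ->
  let f := turn k g in
  (forall z, (triangle A B C)° z <-> [/\ c1 g z < 1, c1 f z < 1 & c1 (turn k' f) z < 1]) ->
  cone f k k' `&` slope f @^-1` J `&` (triangle A B C)° =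
  [set z | 0 < c1 f z < 1 /\ (J `&` `[- k, k'[) (slope f z)].
Proof.
move=> k0 k'0 f inE'; apply/seteqP; split => z /=.
  move=> [[[c0 sz] Jz] /inE'[_ c01 _]]; split; first by rewrite c0.
  by split => //; rewrite in_itv.
move=> [/andP[c0 c01] [Jz]]; rewrite /= in_itv/= => sz; have /andP[sk sk'] := sz.
split; first by split.
apply/inE'; split => //.
  by apply: (coord1_unturn_lt rho0 k0 _ sk); rewrite -/f c0.
by apply: (coord1_turn_lt rho0 k'0) => //; rewrite c0.
Qed.

(** Removes the division: the two linear inequalities already force [c1 f z > 0]. *)
Lemma cone_sides f (a b : R) z : 0 < a + b ->
  cone f a b z <-> 0 <= c2 f z + a * c1 f z /\ c2 f z - b * c1 f z < 0.
Proof.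
move=> ab; rewrite /cone/= /slope; split.
  move=> [c0]; rewrite ler_pdivlMr// ltr_pdivrMr// => /andP[? ?]; lra.
move=> [h1 h2]; have c0 : 0 < c1 f z by rewrite -(pmulr_rgt0 _ ab); lra.
by split => //; rewrite ler_pdivlMr// ltr_pdivrMr//; apply/andP; split; lra.
Qed.

(** In frame coordinates [sideA], [sideB], [sideC] are the cross products of [A - I], [B - I],
    [C - I] with [z - I]. *)
Let sideA z := c2 frameAB z + u * c1 frameAB z.
Let sideB z := c2 frameAB z - v * c1 frameAB z.
Let sideC z := c2 (frameBC v) z - w * c1 (frameBC v) z.

Let side_turn k f z : c2 (turn k f) z + k * c1 (turn k f) z = c2 f z - k * c1 f z.
Proof.
have k1 : 1 + k ^+ 2 != 0 by rewrite gt_eqF// ltr_wpDr ?sqr_ge0.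
by rewrite (coord1_turn _ _ _ rho0) (coord2_turn _ _ _ rho0) /turn_cos /turn_sin; field.
Qed.

Let coneAB z : cone frameAB u v z <-> 0 <= sideA z /\ sideB z < 0.
Proof. by apply: cone_sides; rewrite addr_gt0. Qed.

Let coneBC z : cone (frameBC v) v w z <-> 0 <= sideB z /\ sideC z < 0.
Proof.
by rewrite cone_sides ?addr_gt0// /frameBC side_turn.
Qed.

Let coneCA z : cone (frameCA u) w u z <-> 0 <= sideC z /\ sideA z < 0.
Proof.
by rewrite cone_sides ?addr_gt0// -(side_turn u) (turn_frameCA u) -(turn_frameBC H) side_turn.
Qed.

(** The weights are the side lengths: this is the barycentric relation of the incenter, crossed with
    [z - I]. *)
Let side_sum z : (v + w) * sideA z + (w + u) * sideB z + (u + v) * sideC z = 0.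
Proof.
have k1 : 1 + v ^+ 2 != 0 by rewrite gt_eqF// ltr_wpDr ?sqr_ge0.
have uvN : u * v - 1 != 0 by rewrite gt_eqF// (tangent_uv_gt1 H).
rewrite /sideA /sideB /sideC (coord1_turn _ _ _ rho0) (coord2_turn _ _ _ rho0).
rewrite /turn_cos /turn_sin (tangent_wE H); field.
by rewrite k1 uvN.
Qed.

(** Cyclically the three signs drop from nonnegative to negative somewhere unless they are constant.
    By [side_sum] they cannot all be negative, and all are nonnegative only at the incenter. *)
Lemma cone_cover z : z <> I -> [\/ cone frameAB u v z, cone (frameBC v) v w z | cone (frameCA u) w u z].
Proof.
move=> zI.
suff : [\/ 0 <= sideA z /\ sideB z < 0, 0 <= sideB z /\ sideC z < 0 |
           0 <= sideC z /\ sideA z < 0].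
  by case=> [/coneAB|/coneBC|/coneCA] ?; [exact: Or31|exact: Or32|exact: Or33].
have hu := u0; have hv := v0; have hw := w0; have := side_sum z => hs.
have [hA|hA] := leP 0 (sideA z); have [hB|hB] := ltP (sideB z) 0;
  have [hC|hC] := ltP (sideC z) 0; try (by apply: Or31; split);
  try (by apply: Or32; split); try (by apply: Or33; split).
- have g1 := mulr_ge0 (ltW (addr_gt0 hv hw)) hA.
  have g2 := mulr_ge0 (ltW (addr_gt0 hw hu)) hB.
  have g3 := mulr_ge0 (ltW (addr_gt0 hu hv)) hC.
  have /eqP : (v + w) * sideA z = 0 by lra.
  have /eqP : (w + u) * sideB z = 0 by lra.
  rewrite !mulf_eq0 (gt_eqF (addr_gt0 hw hu)) (gt_eqF (addr_gt0 hv hw))/=.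
  move=> /eqP sB /eqP sA.
  have p0 : c1 frameAB z = 0.
    apply: (mulfI (lt0r_neq0 (addr_gt0 hu hv))); rewrite mulr0.
    by move: sA sB; rewrite /sideA /sideB; lra.
  have q0 : c2 frameAB z = 0 by move: sA; rewrite /sideA p0 mulr0 addr0.
  exfalso; apply: zI.
  rewrite (frame_expand I rho0 (frameNN H) (frameTT H) (frameNT H) z) -/frameAB.
  by rewrite p0 q0 !scale0r !addr0.
- have g1 : 0 < (v + w) * - sideA z by rewrite mulr_gt0 ?addr_gt0 ?oppr_gt0.
  have g2 : 0 < (w + u) * - sideB z by rewrite mulr_gt0 ?addr_gt0 ?oppr_gt0.
  have g3 : 0 < (u + v) * - sideC z by rewrite mulr_gt0 ?addr_gt0 ?oppr_gt0.
  have : 0 < 0 :> R by lra.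
  by rewrite ltxx.
Qed.

Lemma cone_disjoint : [/\ cone frameAB u v `&` cone (frameBC v) v w = set0,
  cone (frameBC v) v w `&` cone (frameCA u) w u = set0 &
  cone (frameCA u) w u `&` cone frameAB u v = set0].
Proof.
split; rewrite -subset0 => z /=.
- by move=> [/coneAB[_ h] /coneBC[h' _]]; rewrite ltNge h' in h.
- by move=> [/coneBC[_ h] /coneCA[h' _]]; rewrite ltNge h' in h.
- by move=> [/coneCA[_ h] /coneAB[h' _]]; rewrite ltNge h' in h.
Qed.

(** Thales: the squared distance from [I] to the midpoint minus the squared radius is the dot
    product. *)
Lemma diameter_diskE P Q : diameter_disk P Q I <-> dot (P - I) (Q - I) <= 0.
Proof.
rewrite /diameter_disk /Defs.edisk/= edist_le ?divr_ge0 ?edist_ge0//.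
rewrite exprMn edist_sqr /dot/= /GRing.scale/=; split => h; lra.
Qed.

Section Law.
Context {d : measure_display} {Omega : measurableType d}.
Variable Pr : probability Omega R.
Implicit Types X Y : {RV Pr >-> (R * R)%type}.

Lemma RV_measurable X (S : set (R * R)) : measurable S -> measurable (X @^-1` S).
Proof. by move=> mS; rewrite -[_ @^-1` _]setTI; exact: measurable_funP. Qed.

Let kappa : \bar R := ((rho / 2)%:E / area (triangle A B C)°)%E.

Let cone_law_kappa X g (k k' : R) : uniform_on (triangle A B C)° X ->
  unit_vector g -> 0 < k -> 0 < k' ->
  let f := turn k g in
  (forall z, (triangle A B C)° z <-> [/\ c1 g z < 1, c1 f z < 1 & c1 (turn k' f) z < 1]) ->
  forall J, measurable J ->
  Pr (X @^-1` (cone f k k' `&` slope f @^-1` J)) = (kappa * mu (J `&` `[(- k)%R, k'[%classic))%E.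
Proof.
move=> hX g1 k0 k'0 f inE' J mJ.
have mS : measurable (cone f k k' `&` slope f @^-1` J).
  apply: measurableI; first exact: measurable_cone.
  by rewrite -[_ @^-1` _]setTI; exact: measurable_slope.
have := hX _ mS; rewrite /distribution /pushforward => ->.
rewrite cone_interior// (area_sector I rho0 (frameNN H) (frameTT H) (frameNT H))//; last 2 first.
- exact: unit_turn.
- exact: measurableI.
by rewrite /kappa muleAC.
Qed.

Let interiorAB z : (triangle A B C)° z <->
  [/\ c1 (frameCA u) z < 1, c1 (turn u (frameCA u)) z < 1 &
      c1 (turn v (turn u (frameCA u))) z < 1].
Proof. by rewrite (turn_frameCA u) (triangle_interiorP H); split => -[]. Qed.

Let interiorBC z : (triangle A B C)° z <->
  [/\ c1 frameAB z < 1, c1 (turn v frameAB) z < 1 & c1 (turn w (turn v frameAB)) z < 1].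
Proof. by rewrite (turn_frameBC H) (triangle_interiorP H); split => -[]. Qed.

Let interiorCA z : (triangle A B C)° z <->
  [/\ c1 (frameBC v) z < 1, c1 (turn w (frameBC v)) z < 1 &
      c1 (turn u (turn w (frameBC v))) z < 1].
Proof.
by rewrite (turn_frameBC H) (turn_frameCA u) (triangle_interiorP H); split => -[].
Qed.

Lemma RV_neq_incenter X : uniform_on (triangle A B C)° X -> Pr (X @^-1` [set I]) = 0%E.
Proof.
move=> hX.
have IE : [set I] = [set I.1] `*` [set I.2].
  apply/seteqP; split => z /=; first by move=> ->.
  by move=> [? ?]; exact: pair_ext.
have mI : measurable [set I] by rewrite IE; exact: measurableX.
have := hX _ mI; rewrite /distribution /pushforward => ->.
have I0 : area [set I] = 0%E.
  have m0 (x : R) : mu [set x] = 0%E by exact: lebesgue_measure_set1.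
  rewrite IE /area; apply: etrans (product_measure1E mu mu _ _) _ => //.
  exact: etrans (congr1 (fun t => t * _)%E (m0 I.1)) (mul0e _).
have [TI|TI] := pselect ((triangle A B C)° I).
  by rewrite setIidl ?I0 ?mul0e// => z ->.
have -> : [set I] `&` (triangle A B C)° = set0.
  by rewrite -subset0 => z /= [->].
have -> : @area R set0 = 0%E by exact: measure0.
by rewrite mul0e.
Qed.

Lemma cone_probability_split X (E : set Omega) : uniform_on (triangle A B C)° X ->
  measurable E ->
  Pr E = (Pr (E `&` X @^-1` cone frameAB u v) +
          Pr (E `&` X @^-1` cone (frameBC v) v w) +
          Pr (E `&` X @^-1` cone (frameCA u) w u))%E.
Proof.
move=> hX mE; have [d1 d2 d3] := cone_disjoint.
have mI : measurable [set I].
  rewrite (_ : [set I] = [set I.1] `*` [set I.2]); first exact: measurableX.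
  by apply/seteqP; split => z /=; [move=> ->|move=> [? ?]; exact: pair_ext].
apply: (@probability_split3 _ _ _ _ _ _ _ _ (X @^-1` [set I])) => //.
- apply: RV_measurable; exact: measurable_cone.
- apply: RV_measurable; exact: measurable_cone.
- apply: RV_measurable; exact: measurable_cone.
- exact: RV_measurable.
- by rewrite -preimage_setI d1 preimage_set0.
- by rewrite -preimage_setI d2 preimage_set0.
- by rewrite -preimage_setI d3 preimage_set0.
- exact: RV_neq_incenter.
- move=> x; have [XI|XI] := pselect (X x = I); first exact: Or44.
  by have [h|h|h] := cone_cover XI; [exact: Or41|exact: Or42|exact: Or43].
Qed.

Let cone_law0 X g (k k' : R) : uniform_on (triangle A B C)° X ->
  unit_vector g -> 0 < k -> 0 < k' ->
  let f := turn k g in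
  (forall z, (triangle A B C)° z <-> [/\ c1 g z < 1, c1 f z < 1 & c1 (turn k' f) z < 1]) ->
  Pr (X @^-1` cone f k k') = (kappa * (k + k')%:E)%E.
Proof.
move=> hX g1 k0 k'0 f inE'.
have := cone_law_kappa hX g1 k0 k'0 inE' measurableT.
rewrite preimage_setT setIT setTI mu_itv; last lra.
by rewrite opprK addrC.
Qed.

Let kappaE X : uniform_on (triangle A B C)° X ->
  kappa = ((2 * (u + v + w))^-1)%:E.
Proof.
move=> hX; have := cone_probability_split hX measurableT.
rewrite !setTI probability_setT.
have := cone_law0 hX (unit_frameCA H) u0 v0 interiorAB; rewrite (turn_frameCA u) => ->.
have := cone_law0 hX unit_frameAB v0 w0 interiorBC => ->.
have := cone_law0 hX (unit_frameBC v) w0 u0 interiorCA; rewrite (turn_frameBC H) => ->.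
have hu := u0; have hv := v0; have hw := w0.
have S0 : 0 < 2 * (u + v + w) by rewrite !(mulr_gt0, addr_gt0).
rewrite -!ge0_muleDr ?lee_fin ?addr_ge0 ?ltW//.
rewrite -!EFinD (_ : u + v + (v + w) + (w + u) = 2 * (u + v + w)); last ring.
have k0 : (0 <= kappa)%E.
  by rewrite mule_ge0 ?lee_fin ?divr_ge0 ?inve_ge0 ?measure_ge0// ltW.
case: kappa k0 => [r r0|_|//].
- move=> /esym; rewrite -EFinM => -[e]; congr EFin.
  by apply: (mulIf (lt0r_neq0 S0)); rewrite e mulVf// lt0r_neq0.
- by rewrite gt0_mulye ?lte_fin.
Qed.

(** In the unit of the inradius [u + v + w] is half the perimeter, so this is the inverse of the
    full perimeter. *)
Definition half_perimeter_inv := (2 * (u + v + w))^-1.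
Let kap := half_perimeter_inv.

Definition follows_cone_law X f (a b : R) := forall J, measurable J ->
  Pr (X @^-1` (cone f a b `&` slope f @^-1` J)) =
  (kap%:E * mu (J `&` `[(- a)%R, b[%classic))%E.

Lemma cone_laws X : uniform_on (triangle A B C)° X ->
  [/\ follows_cone_law X frameAB u v, follows_cone_law X (frameBC v) v w &
      follows_cone_law X (frameCA u) w u].
Proof.
move=> hX; split => J mJ; rewrite /kap /half_perimeter_inv -(kappaE hX).
- by have := cone_law_kappa hX (unit_frameCA H) u0 v0 interiorAB mJ; rewrite (turn_frameCA u).
- exact: (cone_law_kappa hX unit_frameAB v0 w0 interiorBC mJ).
- by have := cone_law_kappa hX (unit_frameBC v) w0 u0 interiorCA mJ; rewrite (turn_frameBC H).
Qed.

Let kap0 : 0 <= kap.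
Proof. by rewrite invr_ge0 !(mulr_ge0, addr_ge0)// ltW. Qed.

Let obtuse X Y w' := dot (X w' - I) (Y w' - I) <= 0.

Lemma probability_same_side X Y f (a b : R) : independent X Y -> unit_vector f ->
  0 < a -> 0 < b -> 1 <= a * b ->
  follows_cone_law X f a b -> follows_cone_law Y f a b ->
  Pr [set x | [/\ cone f a b (X x), cone f a b (Y x) & obtuse X Y x]] =
  (kap * kap * (2 * (a * b - 1 - ln (a * b))))%:E.
Proof.
move=> iXY f1 a0 b0 ab lX lY.
have mK : measurable [set z : R * R | 1 + z.1 * z.2 <= 0].
  by apply: measurable_le_set => //; apply: measurable_funD => //; exact: measurable_funM.
have := joint_law iXY kap0 (measurable_cone f a b) (measurable_cone f a b)
  (measurable_slope I N T rho0 f) (measurable_slope I N T rho0 f)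
  (measurable_itv _) (measurable_itv _) lX lY mK.
rewrite (_ : _ `&` (_ `*` _) = [set z | [/\ - a <= z.1 < b, - a <= z.2 < b & 1 + z.1 * z.2 <= 0]]);
  last first.
  by apply/seteqP; split => z /=; rewrite !in_itv/=; [case=> ? []|case].
rewrite area_same_side// -EFinM => <-; congr (Pr _).
apply/seteqP; split => x /= [cX cY]; have [cX0 _] := cX; have [cY0 _] := cY;
  by rewrite /obtuse (obtuse_same rho0 (frameNN H) (frameTT H) (frameNT H) f1 cX0 cY0).
Qed.

Lemma probability_adjacent_sides X Y f (a k b : R) : independent X Y -> unit_vector f ->
  0 < a -> 0 < k -> 0 < b -> a + k + b = a * k * b ->
  follows_cone_law X f a k -> follows_cone_law Y (turn k f) k b ->
  Pr [set x | [/\ cone f a k (X x), cone (turn k f) k b (Y x) & obtuse X Y x]] =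
  (kap * kap * (a * k + k * b + b * a - 1 + corner_term k))%:E.
Proof.
move=> iXY f1 a0 k0 b0 akb lX lY.
have mK : measurable [set z : R * R |
    (1 - k ^+ 2) * (1 + z.1 * z.2) + 2 * k * (z.1 - z.2) <= 0].
  apply: measurable_le_set => //; apply: measurable_funD; apply: measurable_funM => //.
    by apply: measurable_funD => //; apply: measurable_funM.
  exact: measurable_funB.
have := joint_law iXY kap0 (measurable_cone f a k) (measurable_cone (turn k f) k b)
  (measurable_slope I N T rho0 f) (measurable_slope I N T rho0 (turn k f))
  (measurable_itv _) (measurable_itv _) lX lY mK.
rewrite (_ : _ `&` (_ `*` _) = [set z | [/\ - a <= z.1 < k, - k <= z.2 < b &
    (1 - k ^+ 2) * (1 + z.1 * z.2) + 2 * k * (z.1 - z.2) <= 0]]); last first.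
  by apply/seteqP; split => z /=; rewrite !in_itv/=; [case=> ? []|case].
rewrite area_adjacent_sides// -EFinM => <-; congr (Pr _).
apply/seteqP; split => x /= [cX cY]; have [cX0 _] := cX; have [cY0 _] := cY;
  by rewrite /obtuse (obtuse_adjacent rho0 (frameNN H) (frameTT H) (frameNT H) f1 cX0 cY0).
Qed.

Lemma independent_sym X Y : independent X Y -> independent Y X.
Proof. by move=> iXY S S' mS mS'; rewrite setIC iXY// muleC. Qed.

Lemma probability_adjacent_sides_sym X Y f (a k b : R) : independent X Y -> unit_vector f ->
  0 < a -> 0 < k -> 0 < b -> a + k + b = a * k * b ->
  follows_cone_law Y f a k -> follows_cone_law X (turn k f) k b ->
  Pr [set x | [/\ cone (turn k f) k b (X x), cone f a k (Y x) & obtuse X Y x]] =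
  (kap * kap * (a * k + k * b + b * a - 1 + corner_term k))%:E.
Proof.
move=> iXY f1 a0 k0 b0 akb lY lX.
rewrite -(probability_adjacent_sides (independent_sym iXY) f1 a0 k0 b0 akb lY lX).
have dotC z z' : dot z z' = dot z' z by rewrite /dot; ring.
by congr (Pr _); apply/seteqP; split => x [? ?]; rewrite /obtuse dotC.
Qed.

Lemma probability_obtuse X Y : uniform_on (triangle A B C)° X ->
  uniform_on (triangle A B C)° Y -> independent X Y ->
  Pr [set x | diameter_disk (X x) (Y x) I] = (acute_value u v w)%:E.
Proof.
move=> hX hY iXY.
have hu := u0; have hv := v0; have hw := w0; have uvw := tangent_sum H.
have mE : measurable [set x | obtuse X Y x].
  have m1 (Z : {RV Pr >-> (R * R)%type}) : measurable_fun setT (fun x => (Z x).1 - I.1).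
    by apply: measurable_funB => //; exact: (measurableT_comp measurable_fst).
  have m2 (Z : {RV Pr >-> (R * R)%type}) : measurable_fun setT (fun x => (Z x).2 - I.2).
    by apply: measurable_funB => //; exact: (measurableT_comp measurable_snd).
  apply: measurable_le_set => //; rewrite /dot /=.
  by apply: measurable_funD; apply: measurable_funM.
rewrite (_ : [set x | _] = [set x | obtuse X Y x]); last first.
  by apply/seteqP; split => x /= /diameter_diskE.
have mEX f a b : measurable ([set x | obtuse X Y x] `&` X @^-1` cone f a b).
  by apply: measurableI => //; apply: RV_measurable; exact: measurable_cone.
(* Nine events, by the cones of the two points: three with the same side, six with two adjacent
   sides in either order. *)
rewrite (cone_probability_split hX mE) !(cone_probability_split hY (mEX _ _ _)).
have setE f a b f' a' b' : [set x | obtuse X Y x] `&` X @^-1` cone f a b `&` Y @^-1` cone f' a' b' =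
    [set x | [/\ cone f a b (X x), cone f' a' b' (Y x) & obtuse X Y x]].
  by apply/seteqP; split => x /=; [case=> -[]|case].
rewrite !setE.
have [XAB XBC XCA] := cone_laws hX; have [YAB YBC YCA] := cone_laws hY.
have prod_gt1 (a b c : R) : 0 < a -> 0 < b -> 0 < c -> a + b + c = a * b * c -> 1 <= a * b.
  by move=> a0 b0 c0 abc; rewrite -(ler_pM2r c0); lra.
have vwu : v + w + u = v * w * u by lra.
have wuv : w + u + v = w * u * v by lra.
rewrite (probability_same_side iXY unit_frameAB hu hv (prod_gt1 _ _ _ hu hv hw uvw) XAB YAB).
rewrite (probability_same_side iXY (unit_frameBC v) hv hw (prod_gt1 _ _ _ hv hw hu vwu) XBC YBC).
rewrite (probability_same_side iXY (unit_frameCA H) hw hu (prod_gt1 _ _ _ hw hu hv wuv) XCA YCA).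
rewrite (probability_adjacent_sides iXY unit_frameAB hu hv hw uvw XAB YBC).
rewrite (probability_adjacent_sides_sym iXY unit_frameAB hu hv hw uvw YAB XBC).
have aBC := probability_adjacent_sides iXY (unit_frameBC v) hv hw hu vwu.
have sBC := probability_adjacent_sides_sym iXY (unit_frameBC v) hv hw hu vwu.
have aCA := probability_adjacent_sides iXY (unit_frameCA H) hw hu hv wuv.
have sCA := probability_adjacent_sides_sym iXY (unit_frameCA H) hw hu hv wuv.
rewrite (turn_frameBC H) in aBC sBC; rewrite (turn_frameCA u) in aCA sCA.
rewrite (aBC XBC YCA) (sBC YBC XCA) (aCA XCA YAB) (sCA YCA XAB).
rewrite -!EFinD; congr EFin.
rewrite /acute_value !psi_corner_term// !lnM ?posrE// /kap /half_perimeter_inv.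
have S0 : u + v + w != 0 by rewrite gt_eqF// !addr_gt0.
by field.
Qed.

End Law.
End InscribedProbability.

(** The sides are [Num.sqrt rho] times [u + v], [v + w], [w + u]. *)
Lemma contact_frame_equilateral (R : realType) (A B C I N T : R * R) (rho u v w : R) :
  contact_frame A B C I N T rho u v w -> equilateral A B C <-> u = v /\ v = w.
Proof.
move=> H; have rho0 := frame_gt0 H.
have [u0 v0 w0] := tangent_gt0 H.
have NN := frameNN H; have TT := frameTT H; have NT := frameNT H.
have v1 : 1 + v ^+ 2 != 0 by rewrite gt_eqF// ltr_wpDr ?sqr_ge0.
have uvN : u * v - 1 != 0 by rewrite gt_eqF// (tangent_uv_gt1 H).
have dist (X Y : R * R) x : 0 <= x ->
    (X.1 - Y.1) ^+ 2 + (X.2 - Y.2) ^+ 2 = rho * x ^+ 2 ->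
    Defs.edist X Y = Num.sqrt rho * x.
  by move=> x0 e; rewrite /Defs.edist e sqrtrM ?ltW// sqrtr_sqr ger0_norm.
have scaleE (X Y : R * R) (a b : R) : X = Y + a *: N + b *: T ->
    (X.1 - Y.1) ^+ 2 + (X.2 - Y.2) ^+ 2 = rho * (a ^+ 2 + b ^+ 2).
  move=> ->; rewrite /= /GRing.scale/=.
  transitivity (a ^+ 2 * dot N N + 2 * a * b * dot N T + b ^+ 2 * dot T T).
    by rewrite /dot; ring.
  by rewrite NN NT TT; ring.
have AB : Defs.edist A B = Num.sqrt rho * (u + v).
  apply: dist; first by rewrite addr_ge0 ?ltW.
  rewrite (@scaleE _ _ 0 (- (u + v))); first ring.
  by rewrite (frameA H) (frameB H); apply: pair_ext; rewrite /= /GRing.scale/=; ring.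
have BC : Defs.edist B C = Num.sqrt rho * (v + w).
  apply: dist; first by rewrite addr_ge0 ?ltW.
  rewrite (@scaleE _ _ (2 * v * (v + w) / (1 + v ^+ 2)) (- ((1 - v ^+ 2) * (v + w) / (1 + v ^+ 2)))).
    by field.
  by rewrite (frameB H) (frameC H); apply: pair_ext; rewrite /= /GRing.scale/=; field.
have CA : Defs.edist C A = Num.sqrt rho * (w + u).
  apply: dist; first by rewrite addr_ge0 ?ltW.
  rewrite (@scaleE _ _ (- (2 * v * (v + w) / (1 + v ^+ 2)))
     ((2 * v + w * (1 - v ^+ 2)) / (1 + v ^+ 2) + u)).
    by rewrite (tangent_wE H); field; rewrite v1 uvN.
  by rewrite (frameA H) (frameC H); apply: pair_ext; rewrite /= /GRing.scale/=; field.
have sN : Num.sqrt rho != 0 by rewrite gt_eqF// sqrtr_gt0.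
rewrite /equilateral AB BC CA; split.
  by move=> [/(mulfI sN) e1 /(mulfI sN) e2]; split; lra.
by move=> [-> ->].
Qed.

Theorem theorem4p6 (R : realType) (A B C I : R * R)
  (hABC : nondegenerate_triangle A B C) (hI : is_incenter A B C I)
  (d : measure_display) (Omega : measurableType d) (Pr : probability Omega R)
  (P Q : {RV Pr >-> (R * R)%type})
  (hP : uniform_on (triangle A B C)° P) (hQ : uniform_on (triangle A B C)° Q)
  (hPQ : independent P Q) :
  let D := Pr [set w | diameter_disk (P w) (Q w) I] in
  (D <= (1 / 3 + ln 3 / 6)%:E)%E /\
  (D = (1 / 3 + ln 3 / 6)%:E <-> equilateral A B C).
Proof.
have [N [T [rho [u [v [w H]]]]]] := contact_frame_exists hABC hI.
have [u0 v0 w0] := tangent_gt0 H.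
have [le eq] := acute_value_le u0 v0 w0 (tangent_sum H).
rewrite /= (probability_obtuse H hP hQ hPQ) lee_fin; split => //.
rewrite (contact_frame_equilateral H) -eq.
by split => [[]|->].
Qed.
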